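(* Let $M^*=\bar U\bar V^\top$ for some pair $(\bar U,\bar V)\in\mathcal M(r,B)$, where $r\ge 1$ and $B>0$. Let $\alpha\in(0,1)$, and let $\pi_{n,\alpha}$ be the fractional posterior built from the low-rank factorization prior with hyperparameters $a,b>0$. Put $c_\alpha=\frac{2(\alpha+1)}{1-\alpha}$ if $\alpha\in[0.5,1)$ and $c_\alpha=\frac{2(\alpha+1)}{\alpha}$ if $\alpha\in(0,0.5)$. Then there is a constant $C_{a,B}$, depending only on $a$ and $B$, such that, setting $$\varepsilon_n = C_{a,B}\,\frac{r(d_1+d_2)\log(nd_1d_2)}{n},$$ for a sufficiently small $b>0$, such as $b=\frac{B^2}{512\,(nd_1d_2)^4K^2\max(d_1,d_2)^2}$, it holds that $$\mathbb P\left[\int H^2(P_M,P_{M^*})\,\pi_{n,\alpha}(\mathrm dM)\le c_\alpha\,\varepsilon_n\right]\ge 1-\frac{2}{n\varepsilon_n},$$ where $H$ is the Hellinger distance.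
   Context: Model (1-bit matrix completion). Let $f(x)=e^x/(1+e^x)$ and let $\Pi$ be a fixed probability distribution on $[d_1]\times[d_2]$, where $[m]=\{1,\dots,m\}$. For $M\in\mathbb R^{d_1\times d_2}$, $P_M$ denotes the joint distribution of a pair $(\omega,Y)\in([d_1]\times[d_2])\times\{-1,+1\}$ with $\omega\sim\Pi$ and, given $\omega$, $Y=1$ with probability $f(M_\omega)$ and $Y=-1$ with probability $1-f(M_\omega)$. The data $(\omega_1,Y_1),\dots,(\omega_n,Y_n)$ are i.i.d. from $P_{M^*}$ with $M^*\in\mathbb R^{d_1\times d_2}$; $\mathbb E$ and $\mathbb P$ refer to the law of this sample. Fractional posterior. The likelihood is $L_n(M)=\prod_{s=1}^n f(M_{\omega_s})^{\mathbf 1[Y_s=1]}(1-f(M_{\omega_s}))^{\mathbf 1[Y_s=-1]}$. For $\alpha\in(0,1)$ and a prior $\pi$ on matrices, $\pi_{n,\alpha}(\mathrm dM)\propto L_n(M)^\alpha\,\pi(\mathrm dM)$. Low-rank factorization prior. Fix $K\in\{1,\dots,\min(d_1,d_2)\}$. The prior $\pi$ is the law of $M=LR^\top$, $L\in\mathbb R^{d_1\times K}$, $R\in\mathbb R^{d_2\times K}$, where $\gamma_1,\dots,\gamma_K$ are i.i.d. from $\pi^\gamma$ and, given $\gamma=(\gamma_1,\dots,\gamma_K)$, all rows $L_{i,\cdot}$ ($i\in[d_1]$) and $R_{j,\cdot}$ ($j\in[d_2]$) are i.i.d. $\mathcal N(0,\mathrm{diag}(\gamma))$. Here $\pi^\gamma$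 is either the Gamma distribution $\Gamma(a,b)$ (density $\propto x^{a-1}e^{-bx}$ on $x>0$) or the inverse-Gamma distribution $\Gamma^{-1}(a,b)$ (density $\propto x^{-a-1}e^{-b/x}$ on $x>0$), with $a>0$ a fixed constant and $b>0$ a tuning parameter. Class $\mathcal M(r,B)$. For $1\le r\le K$ and $B>0$, $\mathcal M(r,B)$ is the set of pairs $(\bar U,\bar V)$ of matrices of dimensions $d_1\times K$ and $d_2\times K$ with $\|\bar U\|_\infty\le B$, $\|\bar V\|_\infty\le B$ (maximum absolute entry), and $\bar U_{i,\ell}=0$, $\bar V_{j,\ell}=0$ for all $i,j$ whenever $\ell>r$. Hellinger distance. $H^2(P,Q)=\int\left(\sqrt{\mathrm dP/\mathrm d\mu}-\sqrt{\mathrm dQ/\mathrm d\mu}\right)^2\mathrm d\mu$ for any $\mu$ dominating $P$ and $Q$. *)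

(* Defs.v *)
From HB Require Import structures.
From mathcomp Require Export all_boot all_order all_algebra.
From mathcomp Require Export all_classical all_reals all_analysis measurable_realfun.

Set Implicit Arguments.
Unset Strict Implicit.
Unset Printing Implicit Defensive.

Export Order.TTheory GRing.Theory Num.Theory.
Export numFieldNormedType.Exports.

Local Open Scope classical_set_scope.
Local Open Scope ring_scope.

(* Matrices carry the sigma-algebra generated by the entries, that is the Borel
   sigma-algebra of R^(m x n). *)
Definition measure_matrix_display : measure_display -> measure_display.
Proof. exact. Qed.

Section measurable_matrix.
Context {d} {T : measurableType d} (m n : nat).

Definition mx_cylinders : set (set 'M[T]_(m, n)) :=
  [set S | exists (i : 'I_m) (j : 'I_n), exists2 A : set T, measurable A &
             S = [set M : 'M[T]_(m, n) | A (M i j)]].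

Let mx_sigma : set (set 'M[T]_(m, n)) := <<s mx_cylinders >>.

Let mx_sigma0 : mx_sigma set0.
Proof. exact: sigma_algebra0. Qed.

Let mx_sigmaC A : mx_sigma A -> mx_sigma (~` A).
Proof. exact: sigma_algebraC. Qed.

Let mx_sigma_bigcup (F : (set 'M[T]_(m, n))^nat) :
  (forall i, mx_sigma (F i)) -> mx_sigma (\bigcup_i F i).
Proof. exact: sigma_algebra_bigcup. Qed.

HB.instance Definition _ := @isMeasurable.Build (measure_matrix_display d)
  'M[T]_(m, n) mx_sigma mx_sigma0 mx_sigmaC mx_sigma_bigcup.

Lemma measurable_mx_entry (i : 'I_m) (j : 'I_n) :
  measurable_fun [set: 'M[T]_(m, n)] (fun M => M i j).
Proof.
move=> _ A mA; rewrite setTI.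
by apply: sub_sigma_algebra; exists i, j, A.
Qed.

End measurable_matrix.

Section density_measure.
Local Open Scope ereal_scope.
Context {d} {T : measurableType d} {R : realType}.
Variables (mu : {measure set T -> \bar R}) (w : T -> R).
Hypothesis w_ge0 : forall x, (0 <= w x)%R.
Hypothesis mw : measurable_fun [set: T] w.

(* The measure w(x) mu(dx); the two proofs are only there for the instance. *)
Definition mdensity of (forall x, (0 <= w x)%R) & measurable_fun [set: T] w :=
  fun A : set T => \int[mu]_(x in A) (w x)%:E.

Local Notation md := (mdensity w_ge0 mw).

Let mdensity0 : md set0 = 0.
Proof. by rewrite /mdensity integral_set0. Qed.

Let mdensity_ge0 A : 0 <= md A.
Proof. by apply: integral_ge0 => x _; rewrite lee_fin. Qed.

Let mdensity_sigma_additive : semi_sigma_additive md.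
Proof.
move=> F mF tF mUF; rewrite /mdensity ge0_integral_bigcup//=.
- apply: is_cvg_ereal_nneg_natsum_cond => n _ _.
  by apply: integral_ge0 => x _; rewrite lee_fin.
- by apply/measurable_EFinP; exact: measurable_funTS.
- by move=> x _; rewrite lee_fin.
Qed.

HB.instance Definition _ := isMeasure.Build _ _ _ md
  mdensity0 mdensity_ge0 mdensity_sigma_additive.

End density_measure.

Section variance_laws.
Context {R : realType}.
Variables a b : R.

Definition gamma_weight : R -> R :=
  (fun x => x `^ (a - 1) * expR (- b * x)) \_ `]0, +oo[.

Definition invgamma_weight : R -> R :=
  (fun x => x `^ (- a - 1) * expR (- b / x)) \_ `]0, +oo[.

Lemma gamma_weight_ge0 x : 0 <= gamma_weight x.
Proof.
by apply: restrict_ge0 => y _; rewrite mulr_ge0 ?powR_ge0 ?expR_ge0.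
Qed.

Lemma invgamma_weight_ge0 x : 0 <= invgamma_weight x.
Proof.
by apply: restrict_ge0 => y _; rewrite mulr_ge0 ?powR_ge0 ?expR_ge0.
Qed.

Lemma measurable_gamma_weight : measurable_fun [set: R] gamma_weight.
Proof.
apply/measurable_restrict => //; apply: measurable_funTS.
apply: measurable_funM; first exact: measurable_powR.
by apply: measurableT_comp => //; exact: measurable_funM.
Qed.

Lemma measurable_invgamma_weight : measurable_fun [set: R] invgamma_weight.
Proof.
apply/measurable_restrict => //.
apply: measurable_funM; first by apply: measurable_funTS; exact: measurable_powR.
apply: measurableT_comp => //; apply: measurable_funM => //.
apply: (eq_measurable_fun (fun x : R => x `^ (-1))).
  move=> x; rewrite inE/= in_itv/= andbT => -[_ x0].
  by rewrite /= powR_inv1 ?ltW.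
by apply: measurable_funTS; exact: measurable_powR.
Qed.

(* [mnormalize mu P] is [mu] divided by its total mass; the default [P] is used
   only when that mass is 0 or +oo. *)
Definition gamma_law : probability (measurableTypeR R) R :=
  mnormalize (@mdensity _ (measurableTypeR R) R lebesgue_measure _
                gamma_weight_ge0 measurable_gamma_weight) (@dirac _ (measurableTypeR R) 1 R).

Definition invgamma_law : probability (measurableTypeR R) R :=
  mnormalize (@mdensity _ (measurableTypeR R) R lebesgue_measure _
                invgamma_weight_ge0 measurable_invgamma_weight) (@dirac _ (measurableTypeR R) 1 R).

End variance_laws.

Inductive variance_family := Gamma | InverseGamma.

Definition variance_law (R : realType) (F : variance_family) (a b : R) :
    probability (measurableTypeR R) R :=
  match F with Gamma => gamma_law a b | InverseGamma => invgamma_law a b end.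

(* [pi] is the law of [L *m R^T]: the [gam k] are i.i.d. with law [pig] and,
   conditionally on [gam], all entries of [L] and [R] are independent, those of
   column [k] being N(0, gam k). [normal_prob] takes the standard deviation. *)
Definition lowrank_prior (R : realType) (d1 d2 K : nat)
    (pig : probability (measurableTypeR R) R)
    (pi : probability 'M[R]_(d1, d2) R) : Prop :=
  exists (d : measure_display) (T : measurableType d) (P : probability T R)
         (gam : 'I_K -> {RV P >-> R})
         (L : 'I_d1 -> 'I_K -> {RV P >-> R})
         (Q : 'I_d2 -> 'I_K -> {RV P >-> R}),
  [/\ forall G : 'I_K -> set R, (forall k, measurable (G k)) ->
        P [set t | forall k, G k (gam k t)] = (\prod_(k < K) pig (G k))%E,
      forall (G : 'I_K -> set R)
             (A : 'I_d1 -> 'I_K -> set R) (B : 'I_d2 -> 'I_K -> set R),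
        (forall k, measurable (G k)) ->
        (forall i k, measurable (A i k)) -> (forall j k, measurable (B j k)) ->
        P [set t | [/\ forall k, G k (gam k t),
                       forall i k, A i k (L i k t) &
                       forall j k, B j k (Q j k t)]] =
        (\int[P]_(t in [set t | forall k, G k (gam k t)])
           ((\prod_(i < d1) \prod_(k < K)
               normal_prob 0 (Num.sqrt (gam k t)) (A i k)) *
            (\prod_(j < d2) \prod_(k < K)
               normal_prob 0 (Num.sqrt (gam k t)) (B j k))))%E &
      forall S : set 'M[R]_(d1, d2), measurable S ->
        pi S = P [set t | S ((\matrix_(i < d1, k < K) L i k t) *m
                             (\matrix_(j < d2, k < K) Q j k t)^T)] ].

Section model.
Context {R : realType}.
Variables (d1 d2 : nat).

(* An observation (omega, Y); the label Y = +1 is [true], Y = -1 is [false]. *)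
Definition obs : finType := (('I_d1 * 'I_d2) * bool)%type.

Definition logistic (x : R) : R := expR x / (1 + expR x).

Definition is_pmf (T : finType) (p : T -> R) : Prop :=
  (forall x, 0 <= p x) /\ \sum_x p x = 1.

(* Probability mass function of P_M. *)
Definition obs_pmf (Pi : 'I_d1 * 'I_d2 -> R) (M : 'M[R]_(d1, d2)) (z : obs) : R :=
  Pi z.1 * (if z.2 then logistic (M z.1.1 z.1.2)
            else 1 - logistic (M z.1.1 z.1.2)).

(* Squared Hellinger distance, the dominating measure being the counting
   measure, with respect to which the densities are the mass functions. *)
Definition hellinger2 (T : finType) (p q : T -> R) : R :=
  \sum_x (Num.sqrt (p x) - Num.sqrt (q x)) ^+ 2.

(* Probability of the event [E] for an i.i.d. sample of size [n] from [p]. *)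
Definition sample_prob (T : finType) (n : nat) (p : T -> R)
    (E : set {ffun 'I_n -> T}) : R :=
  \sum_(z : {ffun 'I_n -> T} | z \in E) \prod_(s < n) p (z s).

Definition likelihood (n : nat) (z : {ffun 'I_n -> obs}) (M : 'M[R]_(d1, d2)) : R :=
  \prod_(s < n)
    (logistic (M (z s).1.1 (z s).1.2) ^+ ((z s).2 == true) *
     (1 - logistic (M (z s).1.1 (z s).1.2)) ^+ ((z s).2 == false)).

Definition frac_likelihood (alpha : R) (n : nat) (z : {ffun 'I_n -> obs})
    (M : 'M[R]_(d1, d2)) : R := likelihood z M `^ alpha.

Lemma frac_likelihood_ge0 alpha n (z : {ffun 'I_n -> obs}) M :
  0 <= frac_likelihood alpha z M.
Proof. exact: powR_ge0. Qed.

Lemma measurable_logistic : measurable_fun [set: R] logistic.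
Proof.
apply: measurable_funM => //.
apply: (eq_measurable_fun (fun x : R => (1 + expR x) `^ (-1))).
  by move=> x _; rewrite powR_inv1 // addr_ge0 ?expR_ge0.
apply: (measurableT_comp (measurable_powR _)).
exact: measurable_funD.
Qed.

Lemma measurable_frac_likelihood alpha n (z : {ffun 'I_n -> obs}) :
  measurable_fun [set: 'M[R]_(d1, d2)] (frac_likelihood alpha z).
Proof.
apply: (measurableT_comp (measurable_powR _)).
apply: measurable_prod => s _.
have ml : measurable_fun [set: 'M[R]_(d1, d2)]
    (fun M => logistic (M (z s).1.1 (z s).1.2)).
  by apply: (measurableT_comp measurable_logistic); exact: measurable_mx_entry.
apply: measurable_funM; apply: measurable_funX => //.
exact: measurable_funB.
Qed.

(* pi_{n,alpha}(dM) proportional to L_n(M)^alpha pi(dM). *)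
Definition frac_posterior (alpha : R) (pi : probability 'M[R]_(d1, d2) R)
    (n : nat) (z : {ffun 'I_n -> obs}) : probability 'M[R]_(d1, d2) R :=
  mnormalize (mdensity pi (frac_likelihood_ge0 alpha z)
                (measurable_frac_likelihood alpha z)) pi.

End model.

(* The 0-based column [l] is the column [l + 1] of the usual numbering; [`|U|]
   is the largest absolute value of the entries of [U]. *)
Definition lowrank_class (R : realType) (d1 d2 K r : nat) (B : R)
    (U : 'M[R]_(d1, K)) (V : 'M[R]_(d2, K)) : Prop :=
  [/\ `|U| <= B, `|V| <= B,
      forall (i : 'I_d1) (l : 'I_K), (r <= l)%N -> U i l = 0 &
      forall (j : 'I_d2) (l : 'I_K), (r <= l)%N -> V j l = 0].

Definition c_alpha (R : realType) (alpha : R) : R :=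
  if 2^-1 <= alpha then 2 * (alpha + 1) / (1 - alpha)
  else 2 * (alpha + 1) / alpha.

Definition eps_n (R : realType) (C : R) (r d1 d2 n : nat) : R :=
  C * (r%:R * (d1 + d2)%:R * ln (n * d1 * d2)%:R / n%:R).

Definition b_n (R : realType) (B : R) (d1 d2 K n : nat) : R :=
  B ^+ 2 / (512 * (n * d1 * d2)%:R ^+ 4 * K%:R ^+ 2 * (maxn d1 d2)%:R ^+ 2).

(* Main.v *)
Require Import Defs.
From mathcomp Require Import ring lra.

(** Write A(M) for the affinity sum p_M^alpha p_Mstar^(1 - alpha), which is at most
    exp(- m H^2) with m = min(alpha, 1 - alpha). Hence the integral of
    exp(n m H^2) (L_n(M) / L_n(Mstar))^alpha against the prior has expectation at
    most 1, and Jensen's and Markov's inequalities reduce the theorem to a lower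
    bound on the evidence, the integral of L_n^alpha. That bound needs no
    concentration argument: the logistic log-likelihood is 1-Lipschitz in each
    entry, so L_n(M) >= e^(- n delta) L_n(Mstar) on the sup-norm ball of radius
    delta around Mstar. What remains is the prior mass of this ball for
    delta = (1 + B)^2 / n. It is bounded below by taking gamma_k in [1, 2] for
    k <= r and in [b / 2, b] for k > r: for both variance laws these events have
    probability polynomial in b, hence in n d1 d2. *)

(** The rate has to be r (d1 + d2) log(n d1 d2) although all K columns of both factors are random. A
    coefficient in one of the r active columns may cost a power of n d1 d2; the other coefficients
    may not. With gamma_k <= b, each of them stays within sqrt(12 K b) with probability at least 1 -
    1 / (2 K), so the inactive part of a whole row costs only a factor 2. The K variances cost K
    log(n d1 d2) up to a constant, which fits since K <= d1 + d2.

    With x = n eps, one half of x pays for the prior mass of the ball and the other half for n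
    delta, so the evidence is at least e^(- x) L_n(Mstar)^alpha. As c_alpha m = 2 (alpha + 1), a
    posterior mean of H^2 above c_alpha eps pushes the exponential integral above e^((2 alpha + 1)
    x) L_n(Mstar)^alpha, which leaves the factor e^x used in Markov's inequality. *)

Set Implicit Arguments.
Unset Strict Implicit.
Unset Printing Implicit Defensive.

Local Open Scope classical_set_scope.
Local Open Scope ring_scope.

(** * Fractional affinity *)

Section affinity.
Context {R : realType}.
Implicit Types (u v t theta alpha : R).

(** Young's inequality with the conjugate exponents [theta^-1] and [(1 - theta)^-1]; the endpoints,
    where one of them would be infinite, are treated apart. *)
Lemma powR_young u v theta : 0 <= u -> 0 <= v -> 0 <= theta <= 1 ->
  u `^ theta * v `^ (1 - theta) <= theta * u + (1 - theta) * v.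
Proof.
move=> u0 v0 /andP[]; rewrite le_eqVlt => /predU1P[<- _|t0].
  by rewrite powRr0 subr0 powRr1// mul0r add0r !mul1r.
rewrite le_eqVlt => /predU1P[->|t1].
  by rewrite subrr powRr0 powRr1// mul0r addr0 mulr1 mul1r.
have t'0 : 0 < 1 - theta by rewrite subr_gt0.
have := @conjugate_powR R (u `^ theta) (v `^ (1 - theta))
  theta^-1 (1 - theta)^-1 (powR_ge0 _ _) (powR_ge0 _ _).
rewrite !invr_gt0 t0 t'0 !invrK subrKC => /(_ isT isT erefl).
by rewrite -!powRrM !divff ?gt_eqF// !powRr1// (mulrC u) (mulrC v).
Qed.

(* The free parameter [t] replaces the normalization of [u], which would have
   to divide by the affinity, possibly null. *)
Lemma powR_young_scaled u v t theta : 0 <= u -> 0 <= v -> 0 < t ->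
  0 <= theta <= 1 ->
  u `^ theta * v `^ (1 - theta) <=
  t `^ theta * (theta * (u / t) + (1 - theta) * v).
Proof.
move=> u0 v0 t0 t01.
rewrite -{1}[u](divfK (lt0r_neq0 t0)) powRM ?divr_ge0 ?(ltW t0)//.
rewrite mulrAC mulrC ler_wpM2l ?powR_ge0//.
by apply: powR_young => //; rewrite divr_ge0 ?(ltW t0).
Qed.

Lemma affinityE (T : finType) (p q : T -> R) : is_pmf p -> is_pmf q ->
  \sum_x Num.sqrt (p x * q x) = 1 - hellinger2 p q / 2.
Proof.
move=> [p0 p1] [q0 q1]; rewrite /hellinger2.
under [in RHS]eq_bigr do rewrite sqrrB !sqr_sqrtr// -sqrtrM//.
rewrite big_split/= sumrB p1 q1 sumrMnl -(mulr_natr (\sum_x _) 2).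
by field.
Qed.

(** With [theta = 2 * (1 - alpha)], which lies in [0, 1] because [alpha >= 1/2], each summand is
    [sqrt (p x * q x)] to the power [theta] times [p x] to the power [1 - theta]. The scaled Young
    inequality at [t = exp (- H^2 / 2)] then suffices, since the Hellinger affinity
    [s = 1 - H^2 / 2] is at most [t]. *)
Lemma powR_affinity_le_ge12 (T : finType) (p q : T -> R) alpha :
  is_pmf p -> is_pmf q -> 2^-1 <= alpha <= 1 ->
  \sum_x p x `^ alpha * q x `^ (1 - alpha) <=
  expR (- (1 - alpha) * hellinger2 p q).
Proof.
move=> pp pq /andP[a12 a1].
have [p0 p1] := pp; have [q0 q1] := pq.
set s := \sum_x Num.sqrt (p x * q x).
set theta := 2 * (1 - alpha); set t := expR (- hellinger2 p q / 2).
have t0 : 0 < t by exact: expR_gt0.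
have st : s <= t.
  rewrite /s affinityE//; apply: le_trans (expR_ge1Dx _).
  by rewrite mulNr.
have th01 : 0 <= theta <= 1 by rewrite /theta; apply/andP; split; lra.
have -> : expR (- (1 - alpha) * hellinger2 p q) = t `^ theta.
  by rewrite -expRM; congr expR; rewrite /theta; field.
apply: (@le_trans _ _ (\sum_x t `^ theta *
    (theta * (Num.sqrt (p x * q x) / t) + (1 - theta) * p x))).
  apply: ler_sum => x _.
  apply: le_trans (powR_young_scaled (sqrtr_ge0 _) (p0 x) t0 th01).
  rewrite -powR12_sqrt ?mulr_ge0// -powRrM /theta mulKf// powRM//.
  rewrite mulrAC -powRD; last by apply/implyP => /eqP; lra.
  by rewrite (_ : 1 - alpha + (1 - 2 * (1 - alpha)) = alpha)//; ring.
rewrite -mulr_sumr big_split/= -!mulr_sumr -mulr_suml p1 mulr1 -/s.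
rewrite ler_piMr ?powR_ge0//.
have : s / t <= 1 by rewrite ler_pdivrMr// mul1r.
have /andP[th0 _] := th01; nra.
Qed.

Lemma hellinger2C (T : finType) (p q : T -> R) :
  hellinger2 p q = hellinger2 q p.
Proof. by apply: eq_bigr => x _; rewrite -sqrrN opprB. Qed.

Lemma powR_affinity_le (T : finType) (p q : T -> R) alpha :
  is_pmf p -> is_pmf q -> 0 <= alpha <= 1 ->
  \sum_x p x `^ alpha * q x `^ (1 - alpha) <=
  expR (- Num.min alpha (1 - alpha) * hellinger2 p q).
Proof.
move=> pp pq /andP[a0 a1]; have [a12|a12] := leP (2^-1) alpha.
  rewrite (min_idPr _); last by lra.
  by apply: powR_affinity_le_ge12 => //; rewrite a12.
rewrite (min_idPl _); last by lra.
(* Below 1/2 the roles of [p] and [q], hence of [alpha] and [1 - alpha], are exchanged. *)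
rewrite hellinger2C -[in leRHS](subKr 1 alpha).
under eq_bigr do rewrite mulrC -[X in _ `^ _ * _ `^ X](subKr 1).
by apply: powR_affinity_le_ge12 => //; lra.
Qed.

End affinity.

(** * Logistic likelihood *)

Section likelihood.
Context {R : realType}.

Lemma logistic_gt0 (x : R) : 0 < logistic x.
Proof. by rewrite divr_gt0 ?addr_gt0 ?expR_gt0. Qed.

Lemma onem_logistic (x : R) : 1 - logistic x = logistic (- x).
Proof.
rewrite /logistic expRN; have := expR_gt0 x; set e := expR x => e0.
have ? : e != 0 by rewrite gt_eqF.
by field; apply/andP; split=> //; rewrite gt_eqF//; lra.
Qed.

(** Clearing denominators leaves the sum of two inequalities: [exp y * exp (- d) <= exp x], and
    [exp (x + y) * exp (- d) <= exp (x + y)]. *)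
Lemma logistic_lipschitz (x y d : R) : `|x - y| <= d ->
  logistic y * expR (- d) <= logistic x.
Proof.
move=> xyd; have d0 : 0 <= d by exact: le_trans xyd.
have yxd : expR y * expR (- d) <= expR x.
  by rewrite -expRD ler_expR; move: xyd; rewrite ler_norml => /andP[]; lra.
have ed : expR (- d) <= 1 by rewrite expR_le1; lra.
rewrite /logistic mulrAC ler_pdivrMr ?addr_gt0 ?expR_gt0// mulrAC.
rewrite ler_pdivlMr ?addr_gt0 ?expR_gt0//.
have [ex0 ey0] := (expR_gt0 x, expR_gt0 y).
move: (expR x) (expR y) (expR (- d)) ex0 ey0 yxd ed => ex ey e ex0 ey0 yxd ed.
have : ey * ex * e <= ey * ex by rewrite ler_piMr// mulr_ge0 ?ltW.
by lra.
Qed.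

Variables d1 d2 : nat.
Implicit Types (M : 'M[R]_(d1, d2)) (x : obs d1 d2).

(** The factor of [obs_pmf] that depends on the matrix. It is positive everywhere whereas [Pi] may
    vanish, so likelihoods can be compared without any assumption on the support of [Pi]. *)
Definition label_pmf M x : R :=
  if x.2 then logistic (M x.1.1 x.1.2) else 1 - logistic (M x.1.1 x.1.2).

Lemma label_pmf_gt0 M x : 0 < label_pmf M x.
Proof.
by rewrite /label_pmf; case: ifP; rewrite ?onem_logistic logistic_gt0.
Qed.

Lemma label_pmf_le1 M (x : obs d1 d2) : label_pmf M x <= 1.
Proof.
rewrite /label_pmf; case: ifP => _; last by rewrite gerBl ltW// logistic_gt0.
by rewrite -subr_ge0 onem_logistic ltW// logistic_gt0.
Qed.

Lemma label_pmf_lipschitz M M' x (d : R) :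
  (forall i j, `|M i j - M' i j| <= d) ->
  label_pmf M' x * expR (- d) <= label_pmf M x.
Proof.
move=> MM'; rewrite /label_pmf; case: ifP => _.
  exact: logistic_lipschitz.
by rewrite !onem_logistic logistic_lipschitz// -opprD normrN.
Qed.

Lemma likelihoodE n (z : {ffun 'I_n -> obs d1 d2}) M :
  likelihood z M = \prod_(s < n) label_pmf M (z s).
Proof.
apply: eq_bigr => s _; rewrite /label_pmf.
by case: (z s).2; rewrite /= ?expr0 ?expr1 ?mulr1 ?mul1r.
Qed.

Lemma likelihood_gt0 n (z : {ffun 'I_n -> obs d1 d2}) M : 0 < likelihood z M.
Proof. by rewrite likelihoodE prodr_gt0// => s _; exact: label_pmf_gt0. Qed.

Lemma likelihood_lipschitz n (z : {ffun 'I_n -> obs d1 d2}) M M' (d : R) :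
  (forall i j, `|M i j - M' i j| <= d) ->
  likelihood z M' * expR (- (n%:R * d)) <= likelihood z M.
Proof.
move=> MM'; rewrite !likelihoodE -mulrN mulrC -[n in n%:R]card_ord.
rewrite mulr_natl -sumr_const expR_sum -big_split/=.
apply: ler_prod => s _; rewrite mulrC label_pmf_lipschitz//.
by rewrite mulr_ge0 ?expR_ge0// ltW ?label_pmf_gt0.
Qed.

Variable Pi : 'I_d1 * 'I_d2 -> R.
Hypothesis Pi_pmf : is_pmf Pi.

Lemma obs_pmf_is_pmf M : is_pmf (obs_pmf Pi M).
Proof.
have [Pi0 Pi1] := Pi_pmf; split=> [x|].
  by rewrite mulr_ge0// ltW// label_pmf_gt0.
rewrite -Pi1 -(pair_bigA _ (fun w y => obs_pmf Pi M (w, y)))/=.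
apply: eq_bigr => w _; rewrite big_bool/= /obs_pmf/= -mulrDr.
by rewrite subrKC mulr1.
Qed.

Lemma prod_obs_pmf n (z : {ffun 'I_n -> obs d1 d2}) M :
  \prod_(s < n) obs_pmf Pi M (z s) =
  (\prod_(s < n) Pi (z s).1) * likelihood z M.
Proof. by rewrite likelihoodE -big_split. Qed.

Lemma powR_prod (I : finType) (f : I -> R) a : (forall i, 0 <= f i) ->
  (\prod_i f i) `^ a = \prod_i f i `^ a.
Proof.
move=> f0; rewrite -[RHS]mulr1 -[LHS]mulr1; congr (_ * _).
pose K (x y : R) := 0 <= x /\ x `^ a = y.
have : K (\prod_i f i) (\prod_i f i `^ a).
  apply: (big_ind2 K) => [|x y x' y' [x0 <-] [x'0 <-]|i _].
  - by rewrite /K ler01 powR1.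
  - by rewrite /K mulr_ge0// powRM.
  - by split.
by case.
Qed.

(** The left side is the expectation, under M', of the likelihood ratio of M to M' raised to the
    power [alpha]; absorbing the denominator into the weight avoids any division. Independence of
    the observations turns it into a power of the affinity. *)
Lemma sum_prod_frac_likelihood n alpha M M' : 
  \sum_(z : {ffun 'I_n -> obs d1 d2}) (\prod_(s < n) Pi (z s).1) *
     likelihood z M' `^ (1 - alpha) * frac_likelihood alpha z M =
  (\sum_x obs_pmf Pi M x `^ alpha * obs_pmf Pi M' x `^ (1 - alpha)) ^+ n.
Proof.
rewrite -[n in RHS]card_ord -prodr_const.
rewrite bigA_distr_bigA/=; apply: eq_bigr => z _.
rewrite /frac_likelihood !likelihoodE.
rewrite !powR_prod; last 2 first.
- by move=> i; rewrite ltW// label_pmf_gt0.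
- by move=> i; rewrite ltW// label_pmf_gt0.
rewrite -!big_split/=; apply: eq_bigr => s _.
have [Pi0 _] := Pi_pmf.
rewrite /obs_pmf -/(label_pmf M _) -/(label_pmf M' _).
rewrite !powRM ?(ltW (label_pmf_gt0 _ _))//.
(* This holds at the zeros of [Pi] too, as the two exponents add up to 1. *)
have PiE w : Pi w `^ alpha * Pi w `^ (1 - alpha) = Pi w.
  rewrite -[RHS]powRr1// -[X in _ = _ `^ X](subrKC alpha) [RHS]powRD//.
  by rewrite subrKC oner_eq0.
rewrite -[in LHS]PiE.
move: (Pi _ `^ alpha) (Pi _ `^ (1 - alpha)).
move: (label_pmf M _ `^ _) (label_pmf M' _ `^ _).
by move=> *; ring.
Qed.

Lemma sum_frac_likelihood_le n alpha M M' : 0 <= alpha <= 1 ->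
  \sum_(z : {ffun 'I_n -> obs d1 d2}) (\prod_(s < n) Pi (z s).1) *
     likelihood z M' `^ (1 - alpha) * frac_likelihood alpha z M <=
  expR (- (n%:R * Num.min alpha (1 - alpha) *
           hellinger2 (obs_pmf Pi M) (obs_pmf Pi M'))).
Proof.
move=> a01; rewrite sum_prod_frac_likelihood -mulrA -mulrN expRM_natl -mulNr.
rewrite lerXn2r ?nnegrE ?expR_ge0//.
  by apply: sumr_ge0 => x _; rewrite mulr_ge0 ?powR_ge0.
by apply: powR_affinity_le => //; exact: obs_pmf_is_pmf.
Qed.

Lemma hellinger2_ge0 (T : finType) (p q : T -> R) : 0 <= hellinger2 p q.
Proof. by apply: sumr_ge0 => x _; exact: sqr_ge0. Qed.

Lemma measurable_hellinger2_obs (q : obs d1 d2 -> R) :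
  measurable_fun [set: 'M[R]_(d1, d2)] (fun M => hellinger2 (obs_pmf Pi M) q).
Proof.
apply: measurable_sum => x; apply: measurable_funX.
apply: measurable_funB => //.
have msqrt : measurable_fun [set: R] (@Num.sqrt R).
  by apply: continuous_measurable_fun => y; exact: sqrt_continuous.
apply: (measurableT_comp msqrt).
have ml : measurable_fun [set: 'M[R]_(d1, d2)]
    (fun M => logistic (M x.1.1 x.1.2)).
  by apply: (measurableT_comp measurable_logistic); exact: measurable_mx_entry.
rewrite /obs_pmf; apply: measurable_funM => //.
by case: x.2 => //; exact: measurable_funB.
Qed.

End likelihood.

(** * Measures with a density *)

Section integral_mdensity.
Context d (T : measurableType d) (R : realType).
Variables (mu : {measure set T -> \bar R}) (w : T -> R).
Hypothesis w_ge0 : forall x, 0 <= w x.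
Hypothesis mw : measurable_fun [set: T] w.
Local Open Scope ereal_scope.
Import HBNNSimple.

Local Notation nu := (mdensity mu w_ge0 mw).

Lemma integral_mdensity_nnsfun (h : {nnsfun T >-> R}) :
  \int[nu]_x (h x)%:E = \int[mu]_x ((h x)%:E * (w x)%:E).
Proof.
transitivity (\int[nu]_x
   (\sum_(y \in range h) (y * \1_(h @^-1` [set y]) x)%:E)).
  by apply: eq_integral => t _; rewrite /= fimfunE -fsumEFin.
have indich r : measurable_fun [set: T]
    (fun x => (r * \1_(h @^-1` [set r]) x)%:E).
  by apply/measurable_EFinP; exact: measurable_funM.
have mwE : measurable_fun [set: T] (EFin \o w) by exact/measurable_EFinP.
rewrite ge0_integral_fsum//; last by move=> y x _; exact: nnfun_muleindic_ge0.
transitivity (\int[mu]_x (\sum_(y \in range h)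
    (y * \1_(h @^-1` [set y]) x)%:E * (w x)%:E)); last first.
  apply: eq_integral => x _.
  rewrite -ge0_mule_fsuml => [|y]; last exact: nnfun_muleindic_ge0.
  by rewrite fsumEFin // -(fimfunE _ x).
rewrite ge0_integral_fsum//; last 2 first.
- by move=> y; apply: emeasurable_funM.
- move=> y x _; apply: mule_ge0; first exact: nnfun_muleindic_ge0.
  by rewrite lee_fin.
apply: eq_fsbigr => r rh.
have mr : measurable (h @^-1` [set r]) by [].
have r0 : (0 <= r)%R.
  by move: rh; rewrite inE => -[x _ <-].
under eq_integral do rewrite EFinM.
under [RHS]eq_integral do rewrite EFinM -muleA.
rewrite ge0_integralZl_EFin//; last first.
  by apply/measurable_EFinP; exact: measurable_indic.
rewrite ge0_integralZl_EFin//; last first.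
- apply: emeasurable_funM => //.
  by apply/measurable_EFinP; exact: measurable_indic.
- by move=> x _; rewrite mule_ge0 ?lee_fin.
congr (_ * _); rewrite integral_indic// setIT.
rewrite [LHS](_ : _ = \int[mu]_(x in h @^-1` [set r]) (w x)%:E)//.
rewrite integral_mkcond; apply: eq_integral => x _.
by rewrite epatch_indic muleC.
Qed.

Lemma ge0_integral_mdensity (f : T -> \bar R) : (forall x, 0 <= f x) ->
  measurable_fun [set: T] f ->
  \int[nu]_x f x = \int[mu]_x (f x * (w x)%:E).
Proof.
move=> f0 mf; pose h := nnsfun_approx measurableT mf.
have cvgh x : EFin (h n x) @[n --> \oo] --> f x.
  exact: (@cvg_nnsfun_approx _ _ _ _ measurableT _ mf (fun y _ => f0 y) x).
have -> : \int[nu]_x f x = lim (\int[nu]_x (h n x)%:E @[n --> \oo]).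
  transitivity (\int[nu]_x lim ((h n x)%:E @[n --> \oo])).
    by apply: eq_integral => x _; exact/esym/cvg_lim.
  apply: monotone_convergence => //.
  - by move=> n; apply/measurable_EFinP; exact/measurable_funP.
  - by move=> n x _ /=; rewrite lee_fin.
  - by move=> x _ a b ab; rewrite lee_fin; exact/lefP/nd_nnsfun_approx.
have -> : \int[mu]_x (f x * (w x)%:E) =
    lim (\int[mu]_x ((h n x)%:E * (w x)%:E) @[n --> \oo]).
  transitivity (\int[mu]_x lim ((h n x)%:E * (w x)%:E @[n --> \oo])).
    apply: eq_integral => x _; apply/esym/cvg_lim => //.
    by apply: cvgeZr => //.
  apply: monotone_convergence => //.
  - by move=> n; apply: emeasurable_funM; exact/measurable_EFinP.
  - by move=> n x _; rewrite mule_ge0 ?lee_fin.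
  - move=> x _ a b ab; rewrite lee_wpmul2r ?lee_fin//.
    exact/lefP/nd_nnsfun_approx.
by under eq_fun do rewrite integral_mdensity_nnsfun.
Qed.

(** The total mass is kept as a factor on the left, so that a lower bound on the evidence multiplies
    directly a lower bound on a posterior integral. The first hypothesis excludes the default value
    of [mnormalize]. *)
Lemma ge0_integral_mnormalize (P : probability T R) (f : T -> \bar R) :
  0 < nu [set: T] < +oo -> (forall x, 0 <= f x) -> measurable_fun [set: T] f ->
  \int[mu]_x (w x)%:E * \int[mnormalize nu P]_x f x =
  \int[mu]_x (f x * (w x)%:E).
Proof.
move=> /andP[nu0 nuoo] f0 mf.
have nufin : nu [set: T] \is a fin_num by rewrite ge0_fin_numE// ltW.
have k0 : (0 <= (fine (nu [set: T]))^-1)%R by rewrite invr_ge0 fine_ge0// ltW.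
rewrite -(ge0_integral_mdensity f0 mf).
rewrite [X in _ * X](eq_measure_integral (mscale (NngNum k0) nu)) => [|A mA _].
  rewrite ge0_integral_mscale// (_ : \int[mu]_x (w x)%:E = nu [set: T])//.
  rewrite muleA/= -[X in X * _ * _](fineK nufin).
  by rewrite -EFinM divff ?mul1e// fine_eq0// gt_eqF.
rewrite -[LHS]/(mnormalize nu P A) /mnormalize.
by rewrite (gt_eqF nu0) (lt_eqF nuoo)/= muleC.
Qed.

End integral_mdensity.

(** * Jensen's inequality for the exponential *)

Section jensen.
Context d (T : measurableType d) (R : realType) (P : probability T R).
Local Open Scope ereal_scope.

(** Integrate the tangent at [c]: [exp (k h) >= E * (1 + k h - k c)]. The negative term is moved to
    the other side beforehand, so that both integrands are nonnegative and the integral of [h] may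
    be infinite. *)
Lemma expR_integral_le (h : T -> R) (k c : R) : (0 <= k)%R -> (0 <= c)%R ->
  (forall x, 0 <= h x)%R -> measurable_fun [set: T] h ->
  c%:E <= \int[P]_x (h x)%:E ->
  (expR (k * c))%:E <= \int[P]_x (expR (k * h x))%:E.
Proof.
move=> k0 c0 h0 mh ch; set E := expR (k * c).
have icst r : \int[P]_x r%:E = r%:E.
  by rewrite integral_cst//= [X in _ * X]probability_setT mule1.
have E0 : (0 <= E)%R by exact: expR_ge0.
have mexp : measurable_fun [set: T] (fun x => (expR (k * h x))%:E).
  apply/measurable_EFinP; apply: measurableT_comp => //.
  exact: measurable_funM.
have mhE : measurable_fun [set: T] (fun x => (h x)%:E).
  exact/measurable_EFinP.
have : \int[P]_x (E%:E + (E * k)%:E * (h x)%:E) <=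
       \int[P]_x ((expR (k * h x))%:E + (E * k * c)%:E).
  apply: ge0_le_integral => //.
  - by move=> x _; rewrite adde_ge0 ?lee_fin ?mulr_ge0.
  - by apply: emeasurable_funD => //; apply: emeasurable_funM.
  - exact: emeasurable_funD.
  - move=> x _; rewrite -EFinM -!EFinD lee_fin.
    have -> : expR (k * h x) = (E * expR (k * h x - k * c))%R.
      by rewrite /E -expRD subrKC.
    by have := expR_ge1Dx (k * h x - k * c); nra.
rewrite ge0_integralD//; last 2 first.
- by move=> x _; rewrite mule_ge0 ?lee_fin ?mulr_ge0.
- by apply: emeasurable_funM.
rewrite ge0_integralD//; last by move=> x _; rewrite lee_fin !mulr_ge0.
rewrite ge0_integralZl_EFin ?mulr_ge0//; last by move=> x _; rewrite lee_fin.
rewrite !icst => H.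
rewrite -(leeD2rE _ _ (erefl : (E * k * c)%:E \is a fin_num)).
apply: le_trans H; rewrite leeD2l// EFinM lee_wpmul2l// lee_fin mulr_ge0//.
Qed.

End jensen.

(** * Posterior concentration *)

Section posterior.
Context {R : realType} (d1 d2 n : nat).
Variables (alpha : R) (Pi : 'I_d1 * 'I_d2 -> R) (Mstar : 'M[R]_(d1, d2)).
Variable prior : probability 'M[R]_(d1, d2) R.
Hypothesis Pi_pmf : is_pmf Pi.
Hypothesis alpha01 : 0 < alpha < 1.
Implicit Types (z : {ffun 'I_n -> obs d1 d2}) (M : 'M[R]_(d1, d2)).

Definition sup_ball (delta : R) : set 'M[R]_(d1, d2) :=
  [set M | forall i j, `|M i j - Mstar i j| <= delta].

Lemma measurable_sup_ball delta : measurable (sup_ball delta).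
Proof.
rewrite (_ : sup_ball delta = \bigcap_(i in setT) \bigcap_(j in setT)
   ((fun M : 'M[R]_(d1, d2) => `|M i j - Mstar i j|) @^-1` `]-oo, delta])).
  apply: fin_bigcap_measurable => // i _.
  apply: fin_bigcap_measurable => // j _.
  rewrite -[X in measurable X]setTI.
  have mf : measurable_fun [set: 'M[R]_(d1, d2)]
      (fun M => `|M i j - Mstar i j|).
    apply: measurableT_comp => //; apply: measurable_funB => //.
    exact: measurable_mx_entry.
  by apply: mf.
apply/seteqP; split=> M /= MM; first by move=> i _ j _; rewrite /= in_itv/=.
by move=> i j; have := MM i I j I; rewrite /= in_itv.
Qed.

Let h M := hellinger2 (obs_pmf Pi M) (obs_pmf Pi Mstar).
Let kappa : R := n%:R * Num.min alpha (1 - alpha).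

Let kappa_ge0 : 0 <= kappa.
Proof.
have /andP[a0 a1] := alpha01.
by rewrite mulr_ge0// le_min (ltW a0)/= subr_ge0 ltW.
Qed.

Let mh : measurable_fun [set: 'M[R]_(d1, d2)] h.
Proof. exact: measurable_hellinger2_obs. Qed.

Let mexph : measurable_fun [set: 'M[R]_(d1, d2)] (fun M => expR (kappa * h M)).
Proof. by apply: measurableT_comp => //; exact: measurable_funM. Qed.

Let evidence z := (\int[prior]_M (frac_likelihood alpha z M)%:E)%E.
Let exp_evidence z :=
  (\int[prior]_M ((expR (kappa * h M))%:E * (frac_likelihood alpha z M)%:E))%E.

Lemma frac_likelihood_le1 z M : frac_likelihood alpha z M <= 1.
Proof.
have /andP[a0 a1] := alpha01.
rewrite /frac_likelihood -[leRHS](_ : 1 `^ alpha = 1); last by rewrite powR1.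
rewrite ge0_ler_powR ?nnegrE ?(ltW a0) ?(ltW (likelihood_gt0 _ _))//.
rewrite likelihoodE; apply: Num.Theory.prodr_ile1 => s _.
by rewrite label_pmf_le1 ltW// label_pmf_gt0.
Qed.

Lemma evidence_le1 z : (evidence z <= 1)%E.
Proof.
rewrite -(@probability_setT _ _ _ prior) -[leRHS]mul1e -integral_cst//.
apply: ge0_le_integral => //=.
- by move=> M _; rewrite lee_fin frac_likelihood_ge0.
- by apply/measurable_EFinP; exact: measurable_frac_likelihood.
- by move=> M _; rewrite lee_fin frac_likelihood_le1.
Qed.

Lemma evidence_ge z (delta : R) :
  ((likelihood z Mstar `^ alpha * expR (- (alpha * (n%:R * delta))))%:E *
   prior (sup_ball delta) <= evidence z)%E.
Proof.
have /andP[a0 a1] := alpha01.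
have mS := measurable_sup_ball delta.
rewrite -integral_cst//; apply: (@le_trans _ _
    (\int[prior]_(M in sup_ball delta) (frac_likelihood alpha z M)%:E)%E).
  apply: ge0_le_integral => //=.
  - by move=> M _; rewrite lee_fin mulr_ge0 ?powR_ge0 ?expR_ge0.
  - apply: measurable_funTS; apply/measurable_EFinP.
    exact: measurable_frac_likelihood.
  - move=> M SM; rewrite lee_fin -mulrN [alpha * _]mulrC expRM.
    rewrite -powRM ?expR_ge0 ?(ltW (likelihood_gt0 _ _))//.
    rewrite ge0_ler_powR ?nnegrE ?(ltW a0) ?(ltW (likelihood_gt0 _ _))//.
      by rewrite mulr_ge0 ?expR_ge0 ?(ltW (likelihood_gt0 _ _)).
    exact: likelihood_lipschitz.
apply: ge0_subset_integral => //.
- by apply/measurable_EFinP; exact: measurable_frac_likelihood.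
- by move=> M _; rewrite lee_fin frac_likelihood_ge0.
Qed.

(** This is the expectation over the sample of [exp_evidence z] divided by [likelihood z Mstar] to
    the power [alpha]. The sum over the finite sample space commutes with the prior integral, and
    for each fixed M the factor [exp (kappa * h M)] cancels the affinity bound. *)
Lemma sum_exp_evidence_le :
  (\sum_(z : {ffun 'I_n -> obs d1 d2})
     ((\prod_(s < n) Pi (z s).1) * likelihood z Mstar `^ (1 - alpha))%:E *
       exp_evidence z <= 1)%E.
Proof.
have /andP[a0 a1] := alpha01; have [Pi0 Pi1] := Pi_pmf.
have k0 z : 0 <= (\prod_(s < n) Pi (z s).1) * likelihood z Mstar `^ (1 - alpha).
  by rewrite mulr_ge0 ?powR_ge0// prodr_ge0.
have mGw z : measurable_fun [set: 'M[R]_(d1, d2)]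
    (fun M => ((expR (kappa * h M))%:E * (frac_likelihood alpha z M)%:E)%E).
  apply: emeasurable_funM; apply/measurable_EFinP => //.
  exact: measurable_frac_likelihood.
have Gw0 z M :
    (0 <= (expR (kappa * h M))%:E * (frac_likelihood alpha z M)%:E)%E.
  by rewrite mule_ge0// lee_fin ?expR_ge0 ?frac_likelihood_ge0.
under eq_bigr => z _.
  rewrite -ge0_integralZl_EFin//; over.
rewrite -ge0_integral_sum//; last 2 first.
- by move=> z; apply: emeasurable_funM.
- by move=> z M _; rewrite mule_ge0// lee_fin.
rewrite -(@probability_setT _ _ _ prior) -[leRHS]mul1e -integral_cst//.
apply: ge0_le_integral => //=.
- by move=> M _; rewrite sume_ge0// => z _; rewrite mule_ge0// lee_fin.
- by apply: emeasurable_sum => z; apply: emeasurable_funM.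
move=> M _; rewrite [X in (X <= _)%E](_ : _ = (expR (kappa * h M) *
   \sum_(z : {ffun 'I_n -> obs d1 d2}) (\prod_(s < n) Pi (z s).1) *
     likelihood z Mstar `^ (1 - alpha) * frac_likelihood alpha z M)%:E).
  rewrite lee_fin.
  apply: (@le_trans _ _ (expR (kappa * h M) * expR (- (kappa * h M)))).
    rewrite ler_wpM2l ?expR_ge0//; apply: sum_frac_likelihood_le => //.
    by rewrite !ltW.
  by rewrite -expRD subrr expR0.
move: (expR _) => e; rewrite mulr_sumr -sumEFin; apply: eq_bigr => z _.
by rewrite -!EFinM mulrCA.
Qed.

(** On a bad sample, Jensen under the posterior bounds the posterior mean of [exp (kappa * h)] below
    by [exp (kappa * c)]; multiplying by the evidence turns this posterior mean into the prior
    integral [exp_evidence]. *)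
Lemma bad_sample_exp_evidence (delta x c : R) z :
  0 < x -> n%:R * delta <= x / 2 ->
  ((expR (- (x / 2)))%:E <= prior (sup_ball delta))%E ->
  kappa * c = 2 * (alpha + 1) * x -> 0 <= c ->
  ~ (\int[frac_posterior alpha prior z]_M (h M)%:E <= c%:E)%E ->
  ((expR x * likelihood z Mstar `^ alpha)%:E <= exp_evidence z)%E.
Proof.
have /andP[a0 a1] := alpha01.
move=> x0 dx Sx kc c0 /negP; rewrite -ltNge => /ltW bad.
have ev := evidence_ge z delta.
(* The loss is [alpha * n * delta] plus [x / 2], at most [x] since [alpha < 1]. *)
have ev' : ((likelihood z Mstar `^ alpha * expR (- x))%:E <= evidence z)%E.
  apply: le_trans ev.
  apply: (@le_trans _ _ ((likelihood z Mstar `^ alpha *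
      expR (- (alpha * (n%:R * delta))))%:E * (expR (- (x / 2)))%:E)%E).
    rewrite -EFinM lee_fin -mulrA -expRD ler_wpM2l ?powR_ge0// ler_expR.
    by nra.
  by rewrite lee_wpmul2l// lee_fin mulr_ge0 ?powR_ge0 ?expR_ge0.
have ev0 : (0 < evidence z)%E.
  apply: lt_le_trans ev'.
  by rewrite lte_fin mulr_gt0 ?expR_gt0 ?powR_gt0 ?likelihood_gt0.
have evoo : (evidence z < +oo)%E.
  by rewrite (le_lt_trans (evidence_le1 z)) ?ltry.
have := @expR_integral_le _ _ _ (frac_posterior alpha prior z) h kappa c
  kappa_ge0 c0 (fun M => hellinger2_ge0 _ _) mh bad.
rewrite kc => ecG.
(* The remaining exponent [2 * (alpha + 1) * x - x] is at least [x]. *)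
apply: (@le_trans _ _ (evidence z * (expR (2 * (alpha + 1) * x))%:E)%E).
  apply: le_trans (lee_wpmul2r _ ev'); last by rewrite lee_fin expR_ge0.
  rewrite -EFinM lee_fin mulrC -[leRHS]mulrA -expRD ler_wpM2l ?powR_ge0//.
  by rewrite ler_expR; nra.
rewrite /exp_evidence -(@ge0_integral_mnormalize _ _ _ prior _
  (frac_likelihood_ge0 alpha z) (measurable_frac_likelihood alpha z) prior
  (fun M => (expR (kappa * h M))%:E)).
- by rewrite lee_wpmul2l// ltW.
- by rewrite [X in (0 < X)%E](_ : _ = evidence z)// ev0.
- by move=> M; rewrite lee_fin expR_ge0.
- exact/measurable_EFinP.
Qed.

(** Markov's inequality in weighted form: the probability of a sample is its weight in
    [sum_exp_evidence_le] times [likelihood z Mstar] to the power [alpha], and on a bad sample the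
    latter is at most [exp (- x)] times [exp_evidence z]. *)
Theorem frac_posterior_hellinger2 (delta x c : R) :
  0 < x -> n%:R * delta <= x / 2 ->
  ((expR (- (x / 2)))%:E <= prior (sup_ball delta))%E ->
  kappa * c = 2 * (alpha + 1) * x -> 0 <= c ->
  1 - 2 / x <= sample_prob (obs_pmf Pi Mstar)
    [set z : {ffun 'I_n -> obs d1 d2} |
      (\int[frac_posterior alpha prior z]_M (h M)%:E <= c%:E)%E].
Proof.
move=> x0 dx Sx kc c0; have /andP[a0 a1] := alpha01; have [Pi0 Pi1] := Pi_pmf.
set E := [set z : {ffun _} | _]; rewrite /sample_prob.
pose p (z : {ffun 'I_n -> obs d1 d2}) := \prod_(s < n) obs_pmf Pi Mstar (z s).
have [q0 q1] := obs_pmf_is_pmf Pi_pmf Mstar.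
have p0 z : 0 <= p z by exact: prodr_ge0.
have p1 : \sum_z p z = 1.
  rewrite /p -(bigA_distr_bigA (fun _ : 'I_n => obs_pmf Pi Mstar)).
  by rewrite big1.
have bad : expR x * \sum_(z | z \notin E) p z <= 1.
  rewrite -lee_fin; apply: le_trans sum_exp_evidence_le.
  rewrite [leRHS](bigID (fun z => z \in E))/=.
  apply: (@le_trans _ _ (0 + \sum_(z | z \notin E)
      ((\prod_(s < n) Pi (z s).1) * likelihood z Mstar `^ (1 - alpha))%:E *
       (expR x * likelihood z Mstar `^ alpha)%:E)%E).
    rewrite add0e mulr_sumr -sumEFin; apply: lee_sum => z _.
    rewrite -EFinM lee_fin le_eqVlt; apply/orP; left; apply/eqP.
    have Lz : likelihood z Mstar `^ (1 - alpha) * likelihood z Mstar `^ alpha =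
        likelihood z Mstar.
      by rewrite -powRD ?subrK ?powRr1 ?ltW ?likelihood_gt0 ?oner_eq0.
    by rewrite /p prod_obs_pmf -[X in _ * (_ * X) = _]Lz; ring.
  apply: leeD.
    apply: sume_ge0 => z _.
    rewrite mule_ge0 ?lee_fin ?mulr_ge0 ?powR_ge0 ?prodr_ge0//.
    apply: integral_ge0 => M _.
    by rewrite mule_ge0 ?lee_fin ?expR_ge0 ?frac_likelihood_ge0.
  apply: lee_sum => z zE; rewrite lee_wpmul2l//.
    by rewrite lee_fin mulr_ge0 ?powR_ge0 ?prodr_ge0.
  apply: (bad_sample_exp_evidence x0 dx Sx kc c0).
  by move: zE; rewrite notin_setE.
have -> : \sum_(z | z \in E) p z = 1 - \sum_(z | z \notin E) p z.
  by rewrite -p1 [X in _ = X - _](bigID (fun z => z \in E))/= addrK.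
(* For S the probability of the bad samples, [x * S <= exp x * S <= 1]. *)
rewrite lerD2l lerN2 ler_pdivlMr//.
have := expR_ge1Dx x.
have s0 : 0 <= \sum_(z | z \notin E) p z by exact: sumr_ge0.
by nra.
Qed.

End posterior.

(** * Gaussian small balls *)

Section lebesgue_densities.
Context {R : realType}.
Notation mu := (@lebesgue_measure R).

Lemma integral_itv_ge (f : R -> R) (p q k : R) : p <= q -> 0 <= k ->
  measurable_fun `[p, q] f -> (forall x, p <= x <= q -> k <= f x) ->
  (((q - p) * k)%:E <= \int[mu]_(x in `[p, q]) (f x)%:E)%E.
Proof.
move=> pq k0 mf kf.
have -> : (((q - p) * k)%:E = \int[mu]_(x in `[p, q]) k%:E)%E.
  rewrite integral_cst//= lebesgue_measure_itv/= lte_fin.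
  move: pq; rewrite le_eqVlt => /predU1P[->|->].
    by rewrite ltxx subrr mul0r mule0.
  by rewrite -EFinD -EFinM mulrC.
apply: ge0_le_integral => //=; first exact/measurable_EFinP.
Qed.

(** On this interval [|x| <= B + 1], and [1 <= s ^+ 2 <= 2] bounds both the exponential and the peak
    of the density from below, uniformly in [s]. *)
Lemma normal_prob_itv_ge (s B u t : R) : 0 < s -> 1 <= s ^+ 2 <= 2 -> 0 <= B ->
  `|u| <= B -> 0 <= t <= 1 ->
  ((t * (expR (- (B + 1) ^+ 2) / Num.sqrt (4 * pi)))%:E <=
   normal_prob 0 s `[(u - t)%R, (u + t)%R])%E.
Proof.
move=> s0 /andP[s1 s2] B0 uB /andP[t0 t1].
have p4 : 0 < Num.sqrt (4 * pi) :> R by rewrite sqrtr_gt0 mulr_gt0// pi_gt0.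
set g := _ / _; have g0 : 0 <= g by rewrite divr_ge0 ?expR_ge0 ?ltW.
apply: (@le_trans _ _ ((u + t - (u - t)) * g)%:E).
  by rewrite lee_fin ler_wpM2r//; lra.
apply: integral_itv_ge => //; first by lra.
  by apply: measurable_funTS; exact: measurable_normal_pdf.
move=> x uxt; rewrite normal_pdfE ?gt_eqF// /g mulrC.
apply: ler_pM; rewrite ?expR_ge0 ?invr_ge0 ?sqrtr_ge0//.
  rewrite /normal_peak lef_pV2 ?posrE ?sqrtr_gt0 ?mulr_gt0 ?pi_gt0//.
    rewrite ler_wsqrtr// -mulr_natr.
    by rewrite mulrAC ler_wpM2r ?pi_ge0//; lra.
  by rewrite mulrn_wgt0// mulr_gt0 ?pi_gt0// exprn_gt0.
rewrite /normal_fun ler_expR subr0 mulNr lerN2.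
have xB : x ^+ 2 <= (B + 1) ^+ 2.
  rewrite -(real_normK (num_real x)) lerXn2r ?nnegrE ?addr_ge0//.
  by move: uB; rewrite !ler_norml => /andP[]; lra.
apply: le_trans xB; rewrite ler_pdivrMr ?mulrn_wgt0 ?exprn_gt0//.
by rewrite -mulr_natr; have := sqr_ge0 x; nra.
Qed.

(* On the tail, the density is at most [k] times the one of standard deviation
   [2 * s], so the second moment of the normal law is not needed. *)
Lemma normal_prob_tail (s t : R) : 0 < s -> 0 < t ->
  (normal_prob 0 s (~` `[(- t)%R, t]) <= (6 * s ^+ 2 / t ^+ 2)%:E)%E.
Proof.
move=> s0 t0; have s20 : 0 < 2 * s by rewrite mulr_gt0.
(* The ratio of the two densities at x is [2 * exp (- 3 * x ^+ 2 / (8 * s ^+ 2))], with 3/8 = 1/2 -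
   1/8; [k] is its value at [|x| = t]. *)
pose k := 2 * expR (- (3 * t ^+ 2 / (8 * s ^+ 2))).
have mA : measurable (~` `[- t, t] : set R) by exact: measurableC.
have k0 : 0 <= k by rewrite mulr_ge0 ?expR_ge0.
have s2 : 0 < s ^+ 2 by rewrite exprn_gt0.
have t2 : 0 < t ^+ 2 by rewrite exprn_gt0.
apply: (@le_trans _ _ k%:E); last first.
  rewrite lee_fin /k expRN; set y := 3 * t ^+ 2 / (8 * s ^+ 2).
  have y0 : 0 < y by rewrite divr_gt0 ?mulr_gt0.
  have -> : 6 * s ^+ 2 / t ^+ 2 = 9 / 4 / y.
    by rewrite /y; field; rewrite !gt_eqF.
  rewrite ler_pdivrMr ?expR_gt0// mulrAC ler_pdivlMr//.
  by have := expR_ge1Dx y; lra.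
apply: (@le_trans _ _ (\int[mu]_(x in ~` `[(- t)%R, t])
    (k%:E * (normal_pdf 0 (2 * s) x)%:E))%E).
  apply: ge0_le_integral => //=.
  - by move=> x _; rewrite lee_fin normal_pdf_ge0.
  - apply: measurable_funTS; apply/measurable_EFinP; exact: measurable_normal_pdf.
  - apply: emeasurable_funM => //.
    by apply: measurable_funTS; apply/measurable_EFinP; exact: measurable_normal_pdf.
  move=> x; rewrite in_itv/= -ler_norml => /negP; rewrite -ltNge => tx.
  have tx2 : t ^+ 2 <= x ^+ 2.
    by rewrite -(real_normK (num_real x)) lerXn2r ?nnegrE ?(ltW t0) ?(ltW tx).
  rewrite -EFinM lee_fin !normal_pdfE ?gt_eqF//.
  have -> : normal_peak (2 * s) = normal_peak s / 2.
    rewrite /normal_peak exprMn -mulrA -mulrnAr sqrtrM ?sqr_ge0//.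
    by rewrite sqrtr_sqr ger0_norm// invfM mulrC.
  rewrite /k mulrACA [2 * (_ / 2)]mulrC divfK// ler_wpM2l ?normal_peak_ge0//.
  rewrite /normal_fun subr0 -expRD ler_expR -(mulr_natr (s ^+ 2) 2).
  rewrite -(mulr_natr ((2 * s) ^+ 2) 2) exprMn.
  have -> : - x ^+ 2 / (s ^+ 2 * 2) =
     - (3 * x ^+ 2 / (8 * s ^+ 2)) + - x ^+ 2 / (2 ^+ 2 * s ^+ 2 * 2).
    by field; rewrite gt_eqF.
  rewrite lerD2r lerN2 ler_wpM2r ?ler_wpM2l//.
  by rewrite invr_ge0 mulr_ge0 ?sqr_ge0.
rewrite ge0_integralZl_EFin//; last 2 first.
- by move=> x _; rewrite lee_fin normal_pdf_ge0.
- by apply: measurable_funTS; apply/measurable_EFinP; exact: measurable_normal_pdf.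
rewrite -[leRHS]mule1 lee_wpmul2l//.
exact: (@probability_le1 _ _ _ (normal_prob 0 (2 * s))).
Qed.

Lemma normal_prob_center_ge (s t : R) : 0 < s -> 0 < t ->
  ((1 - 6 * s ^+ 2 / t ^+ 2)%:E <= normal_prob 0 s `[(- t)%R, t])%E.
Proof.
move=> s0 t0; have := normal_prob_tail s0 t0.
rewrite -[X in (X <= _)%E -> _]/(normal_prob 0 s _) probability_setC//.
rewrite -[X in (1 - X)%E]/(normal_prob 0 s _).
have : normal_prob 0 s `[(- t)%R, t] \is a fin_num by exact: fin_num_measure.
case: (normal_prob 0 s _) => // r _.
by rewrite -[(1 - r%:E)%E]/((1 - r)%:E) !lee_fin; lra.
Qed.

End lebesgue_densities.

(** * Variance laws *)

Section primitive.
Context {R : realType}.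
Notation mu := (@lebesgue_measure R).

(** The fundamental theorem of calculus on compact intervals and monotone convergence. Bounding the
    increments of the primitive spares the computation of its limits at 0 and at infinity. *)
Lemma ge0_integral_itv0y_le (f F : R -> R) (M : R) :
  (forall x : R, 0 < x -> 0 <= f x) ->
  (forall x : R, 0 < x -> is_derive x 1 F (f x)) ->
  (forall x : R, 0 < x -> {for x, continuous f}) ->
  (forall x y : R, 0 < x -> x <= y -> F y - F x <= M) ->
  (\int[mu]_(x in `](0%R : R), +oo[) (f x)%:E <= M%:E)%E.
Proof.
move=> f0 dF cf FM.
(* The right end is [i.+2] so that already [J 0], which is [1, 2], is nondegenerate, as
   [continuous_FTC2] requires. *)
pose J (i : nat) : set R := `[i.+1%:R^-1, i.+2%:R]%classic.
have Ji i x : J i x -> 0 < x.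
  by rewrite /J/= in_itv/= => /andP[+ _]; apply: lt_le_trans; rewrite invr_gt0.
have mf : measurable_fun `](0%R : R), +oo[ f.
  apply: open_continuous_measurable_fun => // x.
  by rewrite inE/= in_itv/= andbT; exact: cf.
have J0 i : J i `<=` `](0%R : R), +oo[.
  by move=> x /Ji x0; rewrite /= in_itv/= x0.
have JU : `](0%R : R), +oo[%classic = \bigcup_i J i.
  apply/seteqP; split=> x /=; last first.
    by move=> [i _ /Ji x0]; rewrite in_itv/= x0.
  rewrite in_itv/= andbT => x0.
  exists (maxn (Num.truncn x) (Num.truncn x^-1)) => //.
  rewrite /J/= in_itv/=; apply/andP; split.
    rewrite -[leRHS]invrK lef_pV2 ?posrE ?invr_gt0//.
    by rewrite (le_trans (ltW (truncnS_gt _)))// ler_nat ltnS leq_maxr.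
  rewrite (le_trans (ltW (truncnS_gt _)))// ler_nat ltnS.
  by rewrite (leq_trans (leq_maxl _ (Num.truncn x^-1))).
rewrite JU.
have H : (\int[mu]_(x in J i) (f x)%:E)%E @[i --> \oo] -->
         (\int[mu]_(x in \bigcup_i J i) (f x)%:E)%E.
  apply: ge0_nondecreasing_set_cvg_integral.
  - move=> i j ij; rewrite subsetEset; apply: subset_itv; rewrite bnd_simp.
      by rewrite lef_pV2 ?posrE// ler_nat ltnS.
    by rewrite ler_nat !ltnS.
  - by move=> i; exact: measurable_itv.
  - move=> i; apply/measurable_EFinP; exact: measurable_funS mf.
  - by move=> i x /Ji x0; rewrite lee_fin f0.
apply: (@cvge_le _ _ _ _ _ _ _ _ H).
apply: nearW => i; have i1 : i.+1%:R^-1 < i.+2%:R :> R.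
  by rewrite (@le_lt_trans _ _ 1) ?invf_le1 ?ler1n ?ltr1n.
have i0 : 0 < i.+1%:R^-1 :> R by rewrite invr_gt0.
rewrite (@continuous_FTC2 _ f F)//.
- by rewrite -EFinB lee_fin FM// ltW.
- apply: continuous_in_subspaceT => x; rewrite inE => /Ji; exact: cf.
- have cF (x : R) : 0 < x -> {for x, continuous F}.
    by move=> x0; apply/differentiable_continuous/derivable1_diffP;
      exact: (@ex_derive _ _ _ _ _ _ _ (dF x x0)).
  split.
  + move=> x; rewrite in_itv/= => /andP[/(lt_trans i0) x0 _].
    exact: (@ex_derive _ _ _ _ _ _ _ (dF x x0)).
  + exact/cvg_at_right_filter/cF.
  + exact/cvg_at_left_filter/cF.
- move=> x; rewrite in_itv/= => /andP[/(lt_trans i0) x0 _].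
  by rewrite derive1E; exact: (@derive_val _ _ _ _ _ _ _ (dF x x0)).
Qed.

Lemma is_derive_ln1D (x : R) : 0 < x ->
  is_derive x 1 (fun x : R => ln (1 + x)) (1 + x)^-1.
Proof.
move=> x0; have x1 : 0 < 1 + x by rewrite addr_gt0.
have := @is_derive1_comp _ (@ln R) (fun x => 1 + x) x _ 1 (is_derive1_ln x1).
rewrite mulr1; apply; rewrite -[X in is_derive _ _ _ X]add0r.
exact: is_deriveD.
Qed.

Lemma continuous_ln1D (x : R) :
  0 < x -> {for x, continuous (fun x : R => ln (1 + x))}.
Proof.
move=> x0; apply: differentiable_continuous; apply/derivable1_diffP.
exact: (@ex_derive _ _ _ _ _ _ _ (is_derive_ln1D x0)).
Qed.

(** The integrand x^(a-1) (1+x)^(-a-1) is the beta prime density up to a constant, with the explicit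
    primitive a^(-1) (x / (1+x))^a. Writing powers through [expR] and [ln] reduces later comparisons
    to the exponents. *)
Lemma integral_beta_prime_le (a : R) : 0 < a ->
  (\int[mu]_(x in `](0%R : R), +oo[)
     (expR ((a - 1) * ln x - (a + 1) * ln (1 + x)))%:E <= (a^-1)%:E)%E.
Proof.
move=> a0; pose F (x : R) := a^-1 * expR (a * (ln x - ln (1 + x))).
apply: (@ge0_integral_itv0y_le
  (fun x => expR ((a - 1) * ln x - (a + 1) * ln (1 + x))) F).
- by move=> x _; exact: expR_ge0.
- move=> x x0; have x1 : 0 < 1 + x by rewrite addr_gt0.
  have dl : is_derive x 1 (fun x : R => a * (ln x - ln (1 + x)))
     (a * (x^-1 - (1 + x)^-1)).
    apply: is_deriveZ; apply: is_deriveB; first exact: is_derive1_ln.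
    exact: is_derive_ln1D.
  have de := @is_derive1_comp _ expR _ x _ _ (is_derive_expR _) dl.
  refine (is_derive_eq (is_deriveZ a^-1 de : is_derive x 1 F _) _).
  rewrite /GRing.scale/=.
  have -> : (a - 1) * ln x - (a + 1) * ln (1 + x) =
     a * (ln x - ln (1 + x)) - ln x - ln (1 + x) by ring.
  rewrite !expRB !lnK ?posrE//; field.
  by rewrite !gt_eqF.
- move=> x x0; have x1 : 0 < 1 + x by rewrite addr_gt0.
  apply: (continuous_comp _ (@continuous_expR R _)).
  apply: cvgB; apply: cvgM; try exact: cvg_cst; first exact: continuous_ln.
  exact: continuous_ln1D.
- move=> x y x0 xy; have y0 : 0 < y by exact: lt_le_trans xy.
  have y1 : 0 < 1 + y by rewrite addr_gt0.
  rewrite /F lerBlDr (@le_trans _ _ a^-1)//.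
    rewrite ler_piMr ?invr_ge0 ?(ltW a0)// expR_le1 pmulr_rle0// subr_le0.
    by rewrite ler_ln ?posrE//; lra.
  by rewrite lerDl mulr_ge0 ?expR_ge0 ?invr_ge0 ?(ltW a0).
Qed.

(** The Lomax density up to a constant, with primitive - a^(-1) (1+x)^(-a). *)
Lemma integral_lomax_le (a : R) : 0 < a ->
  (\int[mu]_(x in `](0%R : R), +oo[)
     (expR (- (a + 1) * ln (1 + x)))%:E <= (a^-1)%:E)%E.
Proof.
move=> a0; pose F (x : R) := - a^-1 * expR (- a * ln (1 + x)).
apply: (@ge0_integral_itv0y_le (fun x => expR (- (a + 1) * ln (1 + x))) F).
- by move=> x _; exact: expR_ge0.
- move=> x x0; have x1 : 0 < 1 + x by rewrite addr_gt0.
  have dl := is_deriveZ (- a) (is_derive_ln1D x0).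
  have de := @is_derive1_comp _ expR _ x _ _ (is_derive_expR _) dl.
  refine (is_derive_eq (is_deriveZ (- a^-1) de : is_derive x 1 F _) _).
  rewrite /GRing.scale/=.
  have -> : - (a + 1) * ln (1 + x) = - a * ln (1 + x) - ln (1 + x) by ring.
  by rewrite !expRB !lnK ?posrE//; field; rewrite !gt_eqF.
- move=> x x0; have x1 : 0 < 1 + x by rewrite addr_gt0.
  apply: (continuous_comp _ (@continuous_expR R _)).
  apply: cvgM; first exact: cvg_cst.
  exact: continuous_ln1D.
- move=> x y x0 xy; have y0 : 0 < y by exact: lt_le_trans xy.
  rewrite /F !(mulNr a^-1) opprK addrC lerBlDr (@le_trans _ _ a^-1)//.
    rewrite ler_piMr ?invr_ge0 ?(ltW a0)// expR_le1 mulNr oppr_le0.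
    by rewrite mulr_ge0 ?(ltW a0)// ln_ge0//; lra.
  by rewrite lerDl mulr_ge0 ?expR_ge0 ?invr_ge0 ?(ltW a0).
Qed.

End primitive.

Section variance_laws.
Context {R : realType}.
Variables a b : R.
Hypotheses (a0 : 0 < a) (b0 : 0 < b).
Notation mu := (@lebesgue_measure R).

Lemma gamma_weightE x : 0 < x ->
  gamma_weight a b x = expR ((a - 1) * ln x - b * x).
Proof.
move=> x0; rewrite /gamma_weight patchE mem_set/= ?in_itv/= ?x0//.
by rewrite /powR gt_eqF// -expRD mulNr.
Qed.

Lemma invgamma_weightE x : 0 < x ->
  invgamma_weight a b x = expR (- (a + 1) * ln x - b / x).
Proof.
move=> x0; rewrite /invgamma_weight patchE mem_set/= ?in_itv/= ?x0//.
by rewrite /powR gt_eqF// -expRD mulNr opprD.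
Qed.

(** Bounds the logarithm of (1+y)^(a+1) e^(-b y), the ratio of a variance weight to an explicitly
    integrable function. It grows only like -(a+1) ln b as b tends to 0, so the normalizing constant
    costs a power of b. *)
Definition mass_exponent : R := b + (a + 1) * (ln (a + 1) - ln b).

(* [ln (theta * (1 + y)) < theta * (1 + y)] for [theta := b / (a + 1)]; it is used
   at [y = x] for the Gamma weight and at [y = x^-1] for the inverse-Gamma one. *)
Lemma ln1D_le (y : R) : 0 < y ->
  (a + 1) * ln (1 + y) - b * y <= mass_exponent.
Proof.
move=> y0; have a1 : 0 < a + 1 by rewrite addr_gt0.
have y1 : 0 < 1 + y by rewrite addr_gt0.
have ba : 0 < b / (a + 1) by rewrite divr_gt0.
have := ln_sublinear (mulr_gt0 ba y1).
rewrite lnM ?posrE// ln_div ?posrE//.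
rewrite -(ltr_pM2l a1) mulrA [_ * (b / _)]mulrCA divff ?gt_eqF// mulr1.
by rewrite /mass_exponent; lra.
Qed.

Lemma gamma_weight_le x : 0 < x -> gamma_weight a b x <=
  expR mass_exponent * expR ((a - 1) * ln x - (a + 1) * ln (1 + x)).
Proof.
move=> x0; rewrite gamma_weightE// -expRD ler_expR.
by have := ln1D_le x0; lra.
Qed.

Lemma invgamma_weight_le x : 0 < x -> invgamma_weight a b x <=
  expR mass_exponent * expR (- (a + 1) * ln (1 + x)).
Proof.
move=> x0; rewrite invgamma_weightE// -expRD ler_expR.
have x1 : 0 < 1 + x by rewrite addr_gt0.
have xV : 0 < x^-1 by rewrite invr_gt0.
have := ln1D_le xV; have -> : 1 + x^-1 = (1 + x) / x.
  by rewrite mulrDl mul1r divff ?gt_eqF// addrC.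
by rewrite ln_div ?posrE//; lra.
Qed.

Lemma weight_mass_le (w dom : R -> R) (k : R) :
  (forall x, 0 <= w x) -> measurable_fun [set: R] w ->
  (forall x, x <= 0 -> w x = 0) ->
  0 <= k -> (forall x, 0 < x -> w x <= k * dom x) ->
  (forall x, 0 <= dom x) -> measurable_fun [set: R] dom ->
  (\int[mu]_(x in `](0%R : R), +oo[) (dom x)%:E <= (a^-1)%:E)%E ->
  (\int[mu]_x (w x)%:E <= (k / a)%:E)%E.
Proof.
move=> w0 mw wN k0 wdom dom0 mdom idom.
have -> : (\int[mu]_x (w x)%:E = \int[mu]_(x in `](0%R : R), +oo[) (w x)%:E)%E.
  rewrite [RHS]integral_mkcond; apply: eq_integral => x _.
  rewrite patchE; case: ifPn => //.
  by rewrite notin_setE/= in_itv/= andbT => /negP; rewrite -leNgt => /wN ->.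
apply: (@le_trans _ _
  (\int[mu]_(x in `](0%R : R), +oo[) (k%:E * (dom x)%:E))%E).
  apply: ge0_le_integral => //=.
  - by move=> x _; rewrite lee_fin.
  - by apply: measurable_funTS; exact/measurable_EFinP.
  - apply: emeasurable_funM => //; apply: measurable_funTS.
    exact/measurable_EFinP.
  - by move=> x; rewrite in_itv/= andbT => /wdom; rewrite -EFinM lee_fin.
rewrite ge0_integralZl_EFin//; last 2 first.
- by move=> x _; rewrite lee_fin.
- by apply: measurable_funTS; exact/measurable_EFinP.
by rewrite EFinM lee_wpmul2l.
Qed.

Lemma measurable_ln1D : measurable_fun [set: R] (fun x : R => ln (1 + x)).
Proof. by apply: measurableT_comp => //; exact: measurable_funD. Qed.

Lemma gamma_mass_le :
  (\int[mu]_x (gamma_weight a b x)%:E <= (expR mass_exponent / a)%:E)%E.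
Proof.
apply: (weight_mass_le
  (dom := fun x : R => expR ((a - 1) * ln x - (a + 1) * ln (1 + x)))).
- exact: gamma_weight_ge0.
- exact: measurable_gamma_weight.
- move=> x x0; rewrite /gamma_weight patchE memNset//= in_itv/= andbT.
  by apply/negP; rewrite -leNgt.
- exact: expR_ge0.
- exact: gamma_weight_le.
- by move=> x; exact: expR_ge0.
- apply: measurableT_comp => //.
  apply: measurable_funB; apply: measurable_funM => //.
  exact: measurable_ln1D.
- exact: integral_beta_prime_le.
Qed.

Lemma invgamma_mass_le :
  (\int[mu]_x (invgamma_weight a b x)%:E <= (expR mass_exponent / a)%:E)%E.
Proof.
apply: (weight_mass_le (dom := fun x : R => expR (- (a + 1) * ln (1 + x)))).
- exact: invgamma_weight_ge0.
- exact: measurable_invgamma_weight.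
- move=> x x0; rewrite /invgamma_weight patchE memNset//= in_itv/= andbT.
  by apply/negP; rewrite -leNgt.
- exact: expR_ge0.
- exact: invgamma_weight_le.
- by move=> x; exact: expR_ge0.
- apply: measurableT_comp => //; apply: measurable_funM => //.
  exact: measurable_ln1D.
- exact: integral_lomax_le.
Qed.

(** The two bounds force the total mass to be positive and finite, away from the default [P]. *)
Lemma mnormalize_ge d (T : measurableType d) (nu : {measure set T -> \bar R})
    (P : probability T R) (A : set T) (m M : R) :
  measurable A -> 0 < m -> (m%:E <= nu A)%E -> (nu [set: T] <= M%:E)%E ->
  ((m / M)%:E <= mnormalize nu P A)%E.
Proof.
move=> mA m0 mnu nuM; rewrite /mnormalize.
have nu0 : (0 < nu [set: T])%E.
  apply: (@lt_le_trans _ _ m%:E); first by rewrite lte_fin.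
  by apply: le_trans mnu _; apply: le_measure; rewrite ?inE.
have nuoo : (nu [set: T] < +oo)%E by rewrite (le_lt_trans nuM) ?ltry.
rewrite (gt_eqF nu0) (lt_eqF nuoo)/= EFinM.
have nufin : nu [set: T] \is a fin_num by rewrite ge0_fin_numE// ltW.
have f0 : 0 < fine (nu [set: T]) by rewrite fine_gt0// nu0.
have fM : fine (nu [set: T]) <= M by rewrite -lee_fin fineK.
have M0 : 0 < M by exact: lt_le_trans fM.
by apply: lee_pmul;
  rewrite ?lee_fin ?invr_ge0 ?(ltW m0) ?(ltW M0) ?lef_pV2 ?posrE.
Qed.

Lemma weight_itv_ge (w : R -> R) (w0 : forall x, 0 <= w x)
    (mw : measurable_fun [set: R] w) (P : probability (measurableTypeR R) R)
    (p q l k e : R) :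
  (\int[mu]_x (w x)%:E <= (expR mass_exponent / a)%:E)%E ->
  expR l <= q - p -> (forall x, p <= x <= q -> expR k <= w x) ->
  e + l + k + ln a - mass_exponent >= 0 ->
  ((expR (- e))%:E <=
   mnormalize (@mdensity _ (measurableTypeR R) R lebesgue_measure _ w0 mw) P
     `[p, q])%E.
Proof.
move=> massw lpq kw ek.
apply: (@le_trans _ _ ((expR l * expR k) / (expR mass_exponent / a))%:E).
  rewrite lee_fin invf_div -[in leRHS](@lnK _ a) ?posrE// -expRN -!expRD.
  by rewrite ler_expR; lra.
have pq : p <= q by rewrite -subr_ge0 (le_trans _ lpq) ?expR_ge0.
apply: mnormalize_ge => //; first by rewrite mulr_gt0 ?expR_gt0.
apply: (@le_trans _ _ ((q - p) * expR k)%:E).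
  by rewrite lee_fin ler_wpM2r ?expR_ge0.
by apply: integral_itv_ge => //; exact: measurable_funTS.
Qed.

(** One cost valid for the four cases, Gamma or inverse-Gamma on [1, 2] or [b/2, b], and for every b
    > 0. *)
Definition variance_exponent : R :=
  4 + a + 3 * b + b ^+ 2 + (2 * a + 1) * `|ln b| + (a + 1) * ln (a + 1) - ln a.

Let ln2_le1 : ln 2 <= 1 :> R.
Proof. by have := @le_ln1Dx R 1; apply; lra. Qed.

Let lnb_le : ln b <= `|ln b|. Proof. exact: ler_norm. Qed.
Let lnb_ge : - `|ln b| <= ln b. Proof. by rewrite lerNl -normrN ler_norm. Qed.

Let expR_half : expR (ln b - 1) <= b - b / 2.
Proof.
have -> : b - b / 2 = expR (ln b - ln 2).
  by rewrite expRB !lnK ?posrE//; field.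
by rewrite ler_expR; have := ln2_le1; lra.
Qed.

Lemma variance_law_ge12 F :
  ((expR (- variance_exponent))%:E <=
   variance_law F a b `[(1%R : R), 2%R]%classic)%E.
Proof.
have l12 : expR 0 <= 2 - 1 :> R by rewrite expR0; lra.
have ln12 (x : R) : 1 <= x <= 2 -> 0 < x /\ 0 <= ln x <= 1.
  move=> /andP[x1 x2]; have x0 : 0 < x by lra.
  split=> //; rewrite ln_ge0//= (le_trans _ ln2_le1)// ler_ln ?posrE//.
have ? := a0; have ? := b0; have ? := lnb_le; have ? := lnb_ge.
have aL0 : 0 <= a * `|ln b| by rewrite mulr_ge0 ?(ltW a0).
have aLb : a * ln b <= a * `|ln b| by rewrite ler_wpM2l ?(ltW a0).
have aLb' : - (a * `|ln b|) <= a * ln b by rewrite -mulrN ler_wpM2l ?(ltW a0).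
have b2 := sqr_ge0 b.
case: F.
- apply: (@weight_itv_ge _ _ _ _ _ _ (0) (- 1 - 2 * b)) => //.
  + exact: gamma_mass_le.
  + move=> x x12; have [x0 /andP[l0 l1]] := ln12 _ x12.
    move: x12 => /andP[x1 x2].
    by rewrite gamma_weightE// ler_expR; nra.
  + by rewrite /variance_exponent /mass_exponent; lra.
- apply: (@weight_itv_ge _ _ _ _ _ _ (0) (- (a + 1) - b)) => //.
  + exact: invgamma_mass_le.
  + move=> x x12; have [x0 /andP[l0 l1]] := ln12 _ x12.
    move: x12 => /andP[x1 x2].
    have bx : b / x <= b by rewrite ler_pdivrMr//; nra.
    by rewrite invgamma_weightE// ler_expR; nra.
  + by rewrite /variance_exponent /mass_exponent; lra.
Qed.

Lemma variance_law_ge_half F :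
  ((expR (- variance_exponent))%:E <=
   variance_law F a b `[(b / 2)%R, b]%classic)%E.
Proof.
have lnb (x : R) : b / 2 <= x <= b -> 0 < x /\ ln b - 1 <= ln x <= ln b.
  move=> /andP[x1 x2]; have x0 : 0 < x by rewrite (lt_le_trans _ x1) ?divr_gt0.
  split=> //; rewrite !ler_ln ?posrE// x2 andbT.
  have b20 : 0 < b / 2 by rewrite divr_gt0.
  have : ln (b / 2) <= ln x by rewrite ler_ln ?posrE.
  by rewrite ln_div ?posrE//; have := ln2_le1; lra.
have ? := a0; have ? := b0; have ? := lnb_le; have ? := lnb_ge.
have aL0 : 0 <= a * `|ln b| by rewrite mulr_ge0 ?(ltW a0).
have aLb : a * ln b <= a * `|ln b| by rewrite ler_wpM2l ?(ltW a0).
have aLb' : - (a * `|ln b|) <= a * ln b by rewrite -mulrN ler_wpM2l ?(ltW a0).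
have b2 := sqr_ge0 b.
case: F.
(* As the sign of [a - 1] is unknown, [a * ln x] and [- ln x] are bounded separately, by
   [ln x >= ln b - 1] and [ln x <= ln b]. *)
- apply: (@weight_itv_ge _ _ _ _ _ _
    (ln b - 1) (a * ln b - a - ln b - b ^+ 2)) => //.
  + exact: gamma_mass_le.
  + move=> x xb; have [x0 /andP[l0 l1]] := lnb _ xb.
    move: xb => /andP[x1 x2].
    by rewrite gamma_weightE// ler_expR; nra.
  + by rewrite /variance_exponent /mass_exponent; lra.
- apply: (@weight_itv_ge _ _ _ _ _ _ (ln b - 1) (- (a + 1) * ln b - 2)) => //.
  + exact: invgamma_mass_le.
  + move=> x xb; have [x0 /andP[l0 l1]] := lnb _ xb.
    move: xb => /andP[x1 x2].
    have bx : b / x <= 2 by rewrite ler_pdivrMr//; lra.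
    by rewrite invgamma_weightE// ler_expR; nra.
  + by rewrite /variance_exponent /mass_exponent; lra.
Qed.

End variance_laws.

(** * Prior mass *)

Import HBNNSimple.

(** Stated for an arbitrary [f]: the integral is a supremum over the simple functions below it, and
    [c] times the indicator of [A] is one of them. It is applied to products of normal probabilities
    with random standard deviations, whose measurability is thus never at issue. *)
Lemma integral_ge_cst d (T : measurableType d) (R : realType)
    (mu : {measure set T -> \bar R}) (A : set T) (f : T -> \bar R) (c : R) :
  measurable A -> 0 <= c -> (forall x, A x -> (c%:E <= f x)%E) ->
  (c%:E * mu A <= \int[mu]_(x in A) f x)%E.
Proof.
move=> mA c0 cf.
have f0 x : A x -> (0 <= f x)%E by move=> /cf; apply: le_trans; rewrite lee_fin.
have -> : (c%:E * mu A = sintegral mu (scale_nnsfun (indic_nnsfun R mA) c0))%E.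
  by rewrite sintegralrM sintegral_indic.
rewrite integral_mkcond ge0_integralTE; last by apply: erestrict_ge0.
apply: ereal_sup_ubound => /=.
exists (scale_nnsfun (indic_nnsfun R mA) c0) => //.
move=> x; rewrite /= -[mindic R mA x]/(\1_A x) patchE indicE.
case: ifPn => xA; last by rewrite mulr0.
by rewrite mulr1 cf// -in_setE.
Qed.

Lemma lee_prod_fin (R : realType) (I : finType) (c : I -> R) (f : I -> \bar R) :
  (forall i, 0 <= c i) -> (forall i, ((c i)%:E <= f i)%E) ->
  ((\prod_i c i)%:E <= \prod_i f i)%E.
Proof.
move=> c0 cf.
suff : 0 <= \prod_i c i /\ ((\prod_i c i)%:E <= \prod_i f i)%E by case.
apply: (big_ind2 (fun x (y : \bar R) => 0 <= x /\ (x%:E <= y)%E)).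
- by rewrite ler01.
- move=> x y x' y' [x0 xy] [x'0 xy']; split; first exact: mulr_ge0.
  by rewrite EFinM lee_pmul ?lee_fin.
- by move=> i _; split.
Qed.

Lemma bernoulli_ge (R : realDomainType) (x : R) n : 0 <= x <= 1 ->
  1 - n%:R * x <= (1 - x) ^+ n.
Proof.
move=> /andP[x0 x1]; elim: n => [|n IH]; first by rewrite mul0r subr0 expr0.
rewrite exprS -natr1 (le_trans _ (ler_wpM2l _ IH)) ?subr_ge0//.
have : 0 <= n%:R :> R by []; nra.
Qed.

Section prior_mass.
Context {R : realType}.
Variables (d1 d2 K r : nat).
Hypotheses (K_gt0 : (0 < K)%N) (rK : (r <= K)%N).
Variables (B b t : R).
Hypotheses (B_ge0 : 0 <= B) (b_gt0 : 0 < b) (t01 : 0 < t <= 1).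

Definition normal_floor : R := expR (- (B + 1) ^+ 2) / Num.sqrt (4 * pi).

Let g := normal_floor.

Definition gam_box (k : nat) : set R :=
  if (k < r)%N then `[1, 2]%classic else `[b / 2, b]%classic.

(** Chosen so that for a variance at most [b] the tail bound [6 * s ^+ 2 / t ^+ 2] is at most 1 / (2
    K). *)
Definition noise_radius : R := Num.sqrt (12 * K%:R * b).

Definition coef_box (u : R) (k : nat) : set R :=
  if (k < r)%N then `[u - t, u + t]%classic
  else `[- noise_radius, noise_radius]%classic.

(** A function on [nat], so that the product over the columns can be split at [r]. *)
Definition coef_floor (k : nat) : R :=
  if (k < r)%N then t * g else 1 - (2 * K%:R)^-1.

Let t_gt0 : 0 < t. Proof. by case/andP: t01. Qed.
Let t_le1 : t <= 1. Proof. by case/andP: t01. Qed.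
Let Kr_gt0 : 0 < K%:R :> R. Proof. by rewrite ltr0n. Qed.

Let g_gt0 : 0 < g.
Proof. by rewrite divr_gt0 ?expR_gt0// sqrtr_gt0 mulr_gt0// pi_gt0. Qed.

Lemma noise_radius_gt0 : 0 < noise_radius.
Proof. by rewrite sqrtr_gt0 !mulr_gt0. Qed.

Lemma noise_radius_sqr : noise_radius ^+ 2 = 12 * K%:R * b.
Proof. by rewrite sqr_sqrtr// !mulr_ge0// ltW. Qed.

Lemma invr_2K : 0 <= (2 * K%:R : R)^-1 <= 1.
Proof.
rewrite invr_ge0 mulr_ge0//= invf_le1 ?mulr_gt0//.
have : 1 <= K%:R :> R by rewrite ler1n.
by lra.
Qed.

Lemma coef_floor_ge0 k : 0 <= coef_floor k.
Proof.
rewrite /coef_floor; case: ifP => _; first by rewrite mulr_ge0 ?ltW.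
by rewrite subr_ge0; case/andP: invr_2K.
Qed.

Lemma coef_box_ge (gm u : R) k : gam_box k gm -> `|u| <= B ->
  ((coef_floor k)%:E <= normal_prob 0 (Num.sqrt gm) (coef_box u k))%E.
Proof.
rewrite /gam_box /coef_box /coef_floor; case: ifP => _ /=; rewrite in_itv/=.
  move=> /andP[g1 g2] uB; apply: normal_prob_itv_ge => //.
  - by rewrite sqrtr_gt0; lra.
  - by rewrite sqr_sqrtr ?g1//; lra.
  - by rewrite ltW.
move=> /andP[g1 g2] _.
have gm0 : 0 < gm by rewrite (lt_le_trans _ g1) ?divr_gt0.
have s0 : 0 < Num.sqrt gm by rewrite sqrtr_gt0.
apply: le_trans (normal_prob_center_ge s0 noise_radius_gt0).
rewrite lee_fin sqr_sqrtr ?(ltW gm0)// noise_radius_sqr lerD2l lerN2.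
rewrite ler_pdivrMr ?mulr_gt0//.
have -> : (2 * K%:R)^-1 * (12 * K%:R * b) = 6 * b by field; rewrite gt_eqF.
by rewrite ler_wpM2l.
Qed.

Definition row_floor : R := (t * g) ^+ r * 2^-1.

Lemma row_floor_ge0 : 0 <= row_floor.
Proof.
by rewrite mulr_ge0 ?exprn_ge0 ?mulr_ge0 ?(ltW t_gt0) ?(ltW g_gt0) ?invr_ge0.
Qed.

(** By Bernoulli's inequality the inactive columns contribute at least 1 - (K - r) / (2 K) >= 1/2,
    whatever K. *)
Lemma prod_coef_floor_ge : row_floor <= \prod_(k < K) coef_floor k.
Proof.
rewrite /row_floor.
rewrite -(big_mkord xpredT coef_floor) (big_cat_nat (leq0n r) rK)/=.
rewrite (eq_big_nat _ _ (F2 := fun=> t * g)); last first.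
  by move=> k /andP[_ kr]; rewrite /coef_floor kr.
rewrite [X in _ <= _ * X](eq_big_nat _ _ (F2 := fun=> 1 - (2 * K%:R)^-1));
    last first.
  by move=> k /andP[rk _]; rewrite /coef_floor ltnNge rk.
rewrite !prodr_const_nat subn0.
rewrite ler_wpM2l ?exprn_ge0 ?mulr_ge0 ?(ltW t_gt0) ?(ltW g_gt0)//.
apply: le_trans (bernoulli_ge (K - r) invr_2K).
have : (K - r)%:R <= K%:R :> R by rewrite ler_nat leq_subr.
have : K%:R * (2 * K%:R)^-1 = 2^-1 :> R by field; rewrite gt_eqF.
have /andP[] := invr_2K; nra.
Qed.

Lemma prod_coef_box_ge d (f : 'I_d -> 'I_K -> \bar R) :
  (forall i (k : 'I_K), ((coef_floor k)%:E <= f i k)%E) ->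
  ((row_floor ^+ d)%:E <= \prod_(i < d) \prod_(k < K) f i k)%E.
Proof.
move=> hf; rewrite -[d in _ ^+ d]card_ord -prodr_const.
apply: lee_prod_fin => i; first exact: row_floor_ge0.
apply: (@le_trans _ _ (\prod_(k < K) coef_floor k)%:E).
  by rewrite lee_fin prod_coef_floor_ge.
by apply: lee_prod_fin => // k; exact: coef_floor_ge0.
Qed.

Variables (U : 'M[R]_(d1, K)) (V : 'M[R]_(d2, K)).
Hypothesis UV : lowrank_class r B U V.

Lemma mx_entry_le m n (M : 'M[R]_(m, n)) i j : `|M i j| <= `|M|.
Proof.
rewrite [leRHS]/Num.Def.normr/= mx_normrE.
by apply: (le_bigmax _ (fun ij : 'I_m * 'I_n => `|M ij.1 ij.2|) (i, j)).
Qed.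

(** For an active column, expand around (u, v) and use [t <= 1] on the quadratic term; for an
    inactive one, the product is at most the squared noise radius. The sum of both bounds serves for
    every column. *)
Lemma coef_box_prod (u v x y : R) (k : nat) : `|u| <= B -> `|v| <= B ->
  ((r <= k)%N -> u = 0) -> ((r <= k)%N -> v = 0) ->
  coef_box u k x -> coef_box v k y ->
  `|x * y - u * v| <= t * (2 * B + 1) + 12 * K%:R * b.
Proof.
move=> uB vB u0 v0; have Kb : 0 <= 12 * K%:R * b by rewrite !mulr_ge0// ltW.
have tB : 0 <= t * (2 * B + 1).
  by rewrite mulr_ge0 ?(ltW t_gt0) ?addr_ge0 ?mulr_ge0.
rewrite /coef_box; case: ltnP => [kr|rk] /=; rewrite !in_itv/=.
  rewrite -!ler_distl => xu yv.
  have -> : x * y - u * v = (x - u) * (y - v) + (x - u) * v + u * (y - v).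
    by ring.
  rewrite (le_trans (ler_normD _ _))//.
  rewrite (le_trans (lerD (ler_normD _ _) (lexx _)))//.
  rewrite !normrM.
  have h1 : `|x - u| * `|y - v| <= t * 1.
    by apply: ler_pM => //; exact: le_trans t_le1.
  have h2 : `|x - u| * `|v| <= t * B by apply: ler_pM.
  have h3 : `|u| * `|y - v| <= t * B by rewrite mulrC; apply: ler_pM.
  by lra.
rewrite -!ler_norml u0// v0// mul0r subr0 => xn yn.
rewrite normrM; apply: (@le_trans _ _ (noise_radius * noise_radius)).
  exact: ler_pM.
by rewrite -expr2 noise_radius_sqr lerDr.
Qed.

Variables (pig : probability (measurableTypeR R) R)
          (prior : probability 'M[R]_(d1, d2) R) (p delta : R).
Hypotheses (p_ge0 : 0 <= p)
  (pig12 : (p%:E <= pig `[(1%R : R), 2%R]%classic)%E)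
  (pigb : (p%:E <= pig `[(b / 2)%R, b]%classic)%E)
  (tbd : K%:R * (t * (2 * B + 1) + 12 * K%:R * b) <= delta).

(** Once the variances are in their boxes, the conditional probability of the coefficient boxes is
    bounded below uniformly, so it leaves the integral, and independence of the variances gives
    [p ^+ K]. On the event [W] each entry of the product is a sum of K terms controlled by
    [coef_box_prod]. *)
Lemma lowrank_prior_sup_ball_ge : lowrank_prior K pig prior ->
  ((p ^+ K * row_floor ^+ (d1 + d2))%:E <=
   prior (sup_ball (U *m V^T) delta))%E.
Proof.
move=> [d [T [P [gam [L [Q [gamP LQP priorP]]]]]]].
have [UB VB U0 V0] := UV.
rewrite priorP; last exact: measurable_sup_ball.
have mG (k : 'I_K) : measurable (gam_box k) by rewrite /gam_box; case: ifP.
have mC u (k : nat) : measurable (coef_box u k) by rewrite /coef_box; case: ifP.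
have mpre (X : {RV P >-> R}) (A : set R) : measurable A ->
    measurable [set x | A (X x)].
  by move=> mA; rewrite -[X in measurable X]setTI; exact: measurable_funP.
pose A (i : 'I_d1) (k : 'I_K) := coef_box (U i k) k.
pose A' (j : 'I_d2) (k : 'I_K) := coef_box (V j k) k.
pose GE := [set x | forall k : 'I_K, gam_box k (gam k x)].
have mGE : measurable GE.
  rewrite (_ : GE = \bigcap_(k in [set: 'I_K]) [set x | gam_box k (gam k x)]).
    by apply: fin_bigcap_measurable => // k _; exact: mpre.
  by apply/seteqP; split=> x /= H => [k _|k]; [exact: H|exact: (H k I)].
pose W := [set x | [/\ forall k : 'I_K, gam_box k (gam k x),
                       forall i k, A i k (L i k x) &
                       forall j k, A' j k (Q j k x)]].
have mW : measurable W.
  rewrite (_ : W = GE `&`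
     (\bigcap_(i in [set: 'I_d1]) \bigcap_(k in [set: 'I_K])
        [set x | A i k (L i k x)]) `&`
     (\bigcap_(j in [set: 'I_d2]) \bigcap_(k in [set: 'I_K])
        [set x | A' j k (Q j k x)])).
    apply: measurableI; [apply: measurableI => //|];
      apply: fin_bigcap_measurable => // i _;
      apply: fin_bigcap_measurable => // k _; apply: mpre; exact: mC.
  apply/seteqP; split=> x /=.
    move=> [h1 h2 h3]; split; first by split=> // i _ k _; exact: h2.
    by move=> i _ k _; exact: h3.
  by move=> [[h1 h2] h3]; split=> // i k; [exact: h2|exact: h3].
apply: (@le_trans _ _ (P W)).
  rewrite /W (LQP (fun k => gam_box k) A A')//; last 2 first.
  - by move=> i k; exact: mC.
  - by move=> j k; exact: mC.
  have rf0 m : 0 <= row_floor ^+ m by rewrite exprn_ge0 ?row_floor_ge0.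
  apply: (@le_trans _ _ ((row_floor ^+ (d1 + d2))%:E * P GE)%E).
    rewrite mulrC EFinM lee_wpmul2l ?lee_fin//.
    rewrite /GE (gamP (fun k => gam_box k))// -[K in _ ^+ K]card_ord -prodr_const.
    by apply: lee_prod_fin => // k; rewrite /gam_box; case: ifP.
  apply: integral_ge_cst => // x GEx.
  rewrite exprD EFinM; apply: lee_pmul; rewrite ?lee_fin//.
  - apply: prod_coef_box_ge => i k; apply: coef_box_ge (GEx k) _.
    exact: le_trans (mx_entry_le _ _ _) UB.
  - apply: prod_coef_box_ge => i k; apply: coef_box_ge (GEx k) _.
    exact: le_trans (mx_entry_le _ _ _) VB.
apply: le_measure; rewrite ?inE//.
  rewrite (_ : [set x | _] = \bigcap_(i in setT) \bigcap_(j in setT)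
     ((fun x => `|\sum_k L i k x * Q j k x - (U *m V^T) i j|)
        @^-1` `]-oo, delta])).
    apply: fin_bigcap_measurable => // i _.
    apply: fin_bigcap_measurable => // j _.
    rewrite -[X in measurable X]setTI.
    have mf : measurable_fun [set: T]
        (fun x => `|\sum_k L i k x * Q j k x - (U *m V^T) i j|).
      apply: measurableT_comp => //; apply: measurable_funB => //.
      by apply: measurable_sum => k; exact: measurable_funM.
    by apply: mf.
  have E i j x : ((\matrix_(i, k) L i k x) *m (\matrix_(j, k) Q j k x)^T) i j =
      \sum_k L i k x * Q j k x.
    by rewrite mxE; apply: eq_bigr => k _; rewrite !mxE.
  apply/seteqP; split=> x /= H.
    by move=> i _ j _ /=; rewrite in_itv/= -E; exact: H.
  by move=> i j; have := H i I j I; rewrite /= in_itv/= -E.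
move=> x [_ hL hQ] i j.
rewrite !mxE -sumrB; apply: le_trans tbd.
apply: le_trans (ler_norm_sum _ _ _) _.
rewrite mulr_natl -[K in _ *+ K]card_ord -sumr_const; apply: ler_sum => k _.
rewrite !mxE; apply: (@coef_box_prod _ _ _ _ k).
- exact: le_trans (mx_entry_le _ _ _) UB.
- exact: le_trans (mx_entry_le _ _ _) VB.
- exact: U0.
- exact: V0.
- exact: hL.
- exact: hQ.
Qed.

End prior_mass.

(** * Tuning parameter and constants *)

Lemma ln_monomial (R : realType) (x c u v w : R) :
  0 < x -> 0 < c -> 0 < u -> 0 < v -> 0 < w ->
  ln (x ^+ 2 / (c * u ^+ 4 * v ^+ 2 * w ^+ 2)) =
  2 * ln x - (ln c + 4 * ln u + 2 * ln v + 2 * ln w).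
Proof.
move=> x0 c0 u0 v0 w0.
have cu : 0 < c * u ^+ 4 by rewrite mulr_gt0 ?exprn_gt0.
have cuv : 0 < c * u ^+ 4 * v ^+ 2 by rewrite mulr_gt0 ?exprn_gt0.
have lX (y : R) k : 0 < y -> ln (y ^+ k) = k%:R * ln y.
  by move=> y0; rewrite lnXn// mulr_natl.
rewrite ln_div ?posrE ?exprn_gt0 ?(mulr_gt0 cuv) ?exprn_gt0//.
by rewrite (lnM cuv) ?(lnM cu) ?(lnM c0) ?posrE ?exprn_gt0// !lX.
Qed.

(* [c] abstracts the numeral 512 of [b_n], which unification would unfold in unary
   when comparing it with the casts [N], [K] and [D]. *)
Section tuning.
Context {R : realType}.
Variables c B N K D : R.
Hypotheses (c_ge12 : 12 <= c) (B_gt0 : 0 < B).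
Hypotheses (N_ge1 : 1 <= N) (K_ge1 : 1 <= K) (D_ge1 : 1 <= D).

Definition tuning : R := B ^+ 2 / (c * N ^+ 4 * K ^+ 2 * D ^+ 2).

Let c_gt0 : 0 < c. Proof. by have := c_ge12; lra. Qed.
Let N_gt0 : 0 < N. Proof. exact: lt_le_trans N_ge1. Qed.
Let K_gt0 : 0 < K. Proof. exact: lt_le_trans K_ge1. Qed.
Let D_gt0 : 0 < D. Proof. exact: lt_le_trans D_ge1. Qed.

Let ND_ge : N <= N ^+ 4 * D ^+ 2.
Proof.
have h : N <= N ^+ 4 by rewrite -[leLHS]expr1 ler_weXn2l.
by rewrite (le_trans h)// ler_peMr ?exprn_ge0 ?exprn_ege1 ?(ltW N_gt0).
Qed.

Lemma tuning_gt0 : 0 < tuning.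
Proof. by rewrite divr_gt0 ?exprn_gt0// !mulr_gt0 ?exprn_gt0. Qed.

Lemma ln_tuning :
  ln tuning = 2 * ln B - (ln c + 4 * ln N + 2 * ln K + 2 * ln D).
Proof. by rewrite ln_monomial. Qed.

(** The factor [K ^+ 2] in the denominator of [tuning] cancels both factors [K], [c] absorbs 12, and
    [N ^+ 4 * D ^+ 2] is at least [N]. *)
Lemma tuning_noise_le : K * (12 * K * tuning) <= B ^+ 2 / N.
Proof.
have -> : K * (12 * K * tuning) = B ^+ 2 * (12 / (c * (N ^+ 4 * D ^+ 2))).
  by rewrite /tuning; field; rewrite !gt_eqF.
rewrite ler_wpM2l ?sqr_ge0// ler_pdivrMr; last first.
  by rewrite mulr_gt0// (lt_le_trans N_gt0).
by rewrite mulrC ler_pdivlMr//; apply: ler_pM => //; exact: ltW.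
Qed.

Lemma tuning_le : tuning <= B ^+ 2.
Proof.
have h : K * K * tuning <= B ^+ 2.
  have := tuning_noise_le; rewrite ler_pdivlMr//.
  have [T0 N1] := (ltW tuning_gt0, N_ge1).
  have : 0 <= K * K * tuning by rewrite (mulr_ge0 _ T0) ?mulr_ge0 ?(ltW K_gt0).
  by nra.
apply: le_trans h; rewrite ler_peMl ?(ltW tuning_gt0)//.
by rewrite mulr_ege1.
Qed.

End tuning.

Section constants.
Context {R : realType}.
Variables (a B : R).
Hypotheses (a_gt0 : 0 < a) (B_gt0 : 0 < B).

(** Gives ln N >= 1/2 for N >= 2, so that a nonnegative constant k is absorbed as k <= 2 k ln N. *)
Lemma ln2_ge : 2^-1 <= ln 2 :> R.
Proof.
have : ln (1 + - 2^-1) <= - 2^-1 :> R by apply: le_ln1Dx; lra.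
rewrite (_ : 1 + - 2^-1 = 2^-1) ?lnV ?posrE//; last by field.
by lra.
Qed.

Definition ln_b_const : R := 2 * `|ln B| + ln 512.

Definition exponent_const : R :=
  4 + a + 3 * B ^+ 2 + B ^+ 4 + (2 * a + 1) * ln_b_const +
  (a + 1) * ln (a + 1) + `|ln a|.

Definition variance_const : R := 2 * exponent_const + 8 * (2 * a + 1).

(** The first term makes [n * delta = (1 + B) ^+ 2] at most x / 2. Half of the second pays for the
    prior mass, in units of r (d1 + d2) ln N: [variance_const] for the variances, 1 + 2 |ln g| for
    the active coefficients with g = [normal_floor B], and 1 for the factor 1/2 of each row. *)
Definition rate_const : R :=
  4 * (1 + B) ^+ 2 + 2 * (variance_const + 2 * `|ln (normal_floor B)| + 2).

Lemma ln_b_const_ge0 : 0 <= ln_b_const.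
Proof. by rewrite addr_ge0 ?mulr_ge0// ln_ge0//; lra. Qed.

Lemma exponent_const_ge0 : 0 <= exponent_const.
Proof.
have a1 : 0 <= ln (a + 1) by rewrite ln_ge0// lerDr ltW.
have a0 := ltW a_gt0.
have h1 : 0 <= (2 * a + 1) * ln_b_const.
  by rewrite mulr_ge0 ?ln_b_const_ge0//; lra.
have h2 : 0 <= (a + 1) * ln (a + 1) by rewrite mulr_ge0//; lra.
have h3 := exprn_ge0 2 (ltW B_gt0); have h4 := exprn_ge0 4 (ltW B_gt0).
by have := normr_ge0 (ln a); rewrite /exponent_const; lra.
Qed.

Lemma variance_const_ge0 : 0 <= variance_const.
Proof.
by have := exponent_const_ge0; have := a_gt0; rewrite /variance_const; lra.
Qed.

Lemma rate_const_gt0 : 0 < rate_const.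
Proof.
have := variance_const_ge0; have := sqr_ge0 (1 + B).
by have := normr_ge0 (ln (normal_floor B)); rewrite /rate_const; lra.
Qed.

Variables (d1 d2 K n : nat).
Hypotheses (K_gt0 : (0 < K)%N) (K_le : (K <= minn d1 d2)%N)
  (N_gt1 : (1 < n * d1 * d2)%N).

Let N : R := (n * d1 * d2)%:R.
Let l := ln N.
Let b := b_n B d1 d2 K n.
Let D : R := (maxn d1 d2)%:R.

Let n_gt0 : (0 < n)%N. Proof. by case: n N_gt1 => //; rewrite mul0n. Qed.
Let d1_gt0 : (0 < d1)%N.
Proof. by rewrite (leq_trans K_gt0)// (leq_trans K_le)// geq_minl. Qed.
Let d2_gt0 : (0 < d2)%N.
Proof. by rewrite (leq_trans K_gt0)// (leq_trans K_le)// geq_minr. Qed.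

Let N_ge2 : 2 <= N. Proof. by rewrite ler_nat. Qed.
Let N_gt0 : 0 < N. Proof. by have := N_ge2; lra. Qed.
Let nK_leN : n%:R * K%:R <= N.
Proof.
rewrite -natrM ler_nat -mulnA leq_mul//.
by rewrite (leq_trans K_le)// (leq_trans (geq_minl _ _))// leq_pmulr.
Qed.
Let K_ge1 : 1 <= K%:R :> R. Proof. by rewrite ler1n. Qed.
Let n_ge1 : 1 <= n%:R :> R. Proof. by rewrite ler1n. Qed.
Let D_ge1 : 1 <= D. Proof. by rewrite ler1n leq_max d1_gt0. Qed.
Let D_leN : D <= N.
Proof.
rewrite ler_nat geq_max -mulnA; apply/andP; split.
  by rewrite mulnCA leq_pmulr// muln_gt0 n_gt0.
by rewrite mulnA leq_pmull// muln_gt0 n_gt0.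
Qed.
Let n_leN : n%:R <= N.
Proof. by rewrite (le_trans _ nK_leN)// ler_peMr. Qed.
Let K_leN : K%:R <= N.
Proof. by rewrite (le_trans _ nK_leN)// ler_peMl. Qed.

Lemma ln_sample_ge : 2^-1 <= l.
Proof. by rewrite (le_trans ln2_ge)// ler_ln ?posrE. Qed.

Let ln_le1N (x : R) : 1 <= x -> x <= N -> 0 <= ln x <= l.
Proof. by move=> x1 xN; rewrite ln_ge0//= ler_ln ?posrE//; lra. Qed.

Let ge12_512 : 12 <= 512 :> R. Proof. by rewrite ler_nat. Qed.
Let N_ge1 : 1 <= N. Proof. by have := N_ge2; lra. Qed.

Lemma b_n_gt0 : 0 < b.
Proof. exact: (tuning_gt0 ge12_512 B_gt0 N_ge1 K_ge1 D_ge1). Qed.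

Lemma b_n_le : b <= B ^+ 2.
Proof. exact: (tuning_le ge12_512 B_gt0 N_ge1 K_ge1 D_ge1). Qed.

(** The 8 is the sum of the exponents 4, 2, 2 of n d1 d2, K and max(d1, d2) in [b_n], the last two
    quantities being at most n d1 d2. *)
Lemma ln_b_n : `|ln b| <= ln_b_const + 8 * l.
Proof.
have D0 : 0 < D by have := D_ge1; lra.
have K0 : 0 < K%:R :> R by have := K_ge1; lra.
have /andP[lK0 lKl] := ln_le1N K_ge1 K_leN.
have /andP[lD0 lDl] := ln_le1N D_ge1 D_leN.
have l512 : 0 <= ln 512 :> R by rewrite ln_ge0//; lra.
have lb : ln b = 2 * ln B - (ln 512 + 4 * l + 2 * ln K%:R + 2 * ln D).
  exact: (ln_tuning ge12_512 B_gt0 N_ge1 K_ge1 D_ge1).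
rewrite /ln_b_const ler_norml.
move: (ln b) (ln 512) lb l512 => lnb ln512 -> l512.
have := ln_sample_ge; have := ler_norm (ln B); have := ler_norm (- ln B).
by rewrite normrN; lra.
Qed.

Lemma variance_exponent_le : variance_exponent a b <= variance_const * l.
Proof.
have b0 := ltW b_n_gt0; have bB := b_n_le; have lb := ln_b_n.
have l2 := ln_sample_ge.
have bb : b ^+ 2 <= B ^+ 4.
  by rewrite (_ : 4 = 2 * 2)%N// exprM lerXn2r ?nnegrE ?sqr_ge0.
have la : - ln a <= `|ln a| by rewrite -normrN ler_norm.
have a1 : 0 <= 2 * a + 1 by rewrite addr_ge0 ?mulr_ge0 ?(ltW a_gt0).
have h : (2 * a + 1) * `|ln b| <= (2 * a + 1) * (ln_b_const + 8 * l).
  by rewrite ler_wpM2l.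
have k0 : exponent_const <= 2 * exponent_const * l.
  by have := exponent_const_ge0; nra.
apply: (@le_trans _ _ (exponent_const + (2 * a + 1) * (8 * l))); last first.
  by rewrite /variance_const; lra.
by rewrite /variance_exponent /exponent_const; lra.
Qed.

(** The half-width [t] of the active boxes is taken to be 1 / N. Since n K <= N, the active columns
    contribute at most (2 B + 1) / n and the noise at most B^2 / n, whence the square of 1 + B. *)
Lemma sup_ball_radius_le :
  K%:R * (N^-1 * (2 * B + 1) + 12 * K%:R * b) <= (1 + B) ^+ 2 / n%:R.
Proof.
have n0 : 0 < n%:R :> R by have := n_ge1; lra.
have K0 : 0 < K%:R :> R by have := K_ge1; lra.
have D0 : 0 < D by have := D_ge1; lra.
have h1 : K%:R * (N^-1 * (2 * B + 1)) <= (2 * B + 1) / n%:R.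
  rewrite mulrA mulrC ler_wpM2l ?addr_ge0 ?mulr_ge0 ?(ltW B_gt0)//.
  by rewrite ler_pdivrMr// mulrC ler_pdivlMr// mulrC.
have h2 : K%:R * (12 * K%:R * b) <= B ^+ 2 / n%:R.
  have h : K%:R * (12 * K%:R * b) <= B ^+ 2 / N.
    exact: (tuning_noise_le B ge12_512 N_ge1 K_ge1 D_ge1).
  apply: (le_trans h).
  by rewrite ler_wpM2l ?sqr_ge0// lef_pV2 ?posrE.
have -> : (1 + B) ^+ 2 / n%:R = (2 * B + 1) / n%:R + B ^+ 2 / n%:R.
  by rewrite -mulrDl; congr (_ / _); ring.
by rewrite mulrDr lerD.
Qed.

Variables (r : nat) (Fam : variance_family).
Variables (U : 'M[R]_(d1, K)) (V : 'M[R]_(d2, K)).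
Variable prior : probability 'M[R]_(d1, d2) R.
Hypotheses (r_gt0 : (0 < r)%N) (r_le : (r <= K)%N) (UV : lowrank_class r B U V)
  (priorP : lowrank_prior K (variance_law Fam a b) prior).

Lemma lowrank_prior_mass :
  ((expR (- (rate_const * (r%:R * (d1 + d2)%:R * l) / 2)))%:E <=
   prior (sup_ball (U *m V^T) ((1 + B) ^+ 2 / n%:R)))%E.
Proof.
have N1 : 0 < N^-1 <= 1.
  by rewrite invr_gt0 N_gt0 invf_le1//; have := N_ge2; lra.
have p12 : ((expR (- (variance_const * l)))%:E <=
    variance_law Fam a b `[(1%R : R), 2%R]%classic)%E.
  apply: le_trans (variance_law_ge12 a_gt0 b_n_gt0 Fam).
  by rewrite lee_fin ler_expR lerN2 variance_exponent_le.
have pb : ((expR (- (variance_const * l)))%:E <=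
    variance_law Fam a b `[(b / 2)%R, b]%classic)%E.
  apply: le_trans (variance_law_ge_half a_gt0 b_n_gt0 Fam).
  by rewrite lee_fin ler_expR lerN2 variance_exponent_le.
apply: le_trans (lowrank_prior_sup_ball_ge K_gt0 r_le (ltW B_gt0) b_n_gt0 N1 UV
  (expR_ge0 _) p12 pb sup_ball_radius_le priorP).
set g := normal_floor B.
have g0 : 0 < g by rewrite divr_gt0 ?expR_gt0// sqrtr_gt0 mulr_gt0// pi_gt0.
rewrite lee_fin /row_floor; set x := _ / 2.
have -> : N^-1 * g = expR (- l + ln g) by rewrite expRD expRN !lnK ?posrE.
have -> : 2^-1 = expR (- ln 2) :> R by rewrite expRN lnK ?posrE.
rewrite -!expRM_natl -expRD -expRM_natl -expRD ler_expR.
have l2 := ln_sample_ge.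
have ln2l : ln 2 <= l by rewrite ler_ln ?posrE.
have gl : - (2 * `|ln g| * l) <= ln g.
  have : - ln g <= `|ln g| by rewrite -normrN ler_norm.
  have : `|ln g| <= 2 * l * `|ln g| by rewrite ler_peMl//; lra.
  by lra.
have r1 : 1 <= r%:R :> R by rewrite ler1n.
have Kd : K%:R <= (d1 + d2)%:R :> R.
  by rewrite ler_nat (leq_trans K_le)// (leq_trans (geq_minl _ _))// leq_addr.
set d := (d1 + d2)%:R in Kd *.
have d1' : 1 <= d by have := K_ge1; lra.
have v0 := variance_const_ge0.
have Kdr : K%:R <= r%:R * d by rewrite (le_trans Kd)// ler_peMl//; lra.
(* [t1], [t2], [t3] bound the logarithmic costs of the K variances, of the active coefficients and
   of the factors 1/2; [t4] discards the part of [rate_const] reserved for the radius. *)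
have t1 : K%:R * (variance_const * l) <= r%:R * d * (variance_const * l).
  by rewrite ler_wpM2r// mulr_ge0//; lra.
have t2 : d * (r%:R * (l + 2 * `|ln g| * l)) >= d * (r%:R * (l - ln g)).
  by rewrite ler_wpM2l ?ler_wpM2l//; lra.
have t3 : d * ln 2 <= r%:R * d * l.
  have dr : d <= r%:R * d by rewrite ler_peMl//; lra.
  by apply: ler_pM => //; have := ln2_ge; lra.
have t4 : 0 <= (1 + B) ^+ 2 * (r%:R * d * l).
  by rewrite mulr_ge0 ?sqr_ge0// !mulr_ge0//; lra.
rewrite /x /rate_const -/g; lra.
Qed.

End constants.

Theorem corollary3 (R : realType) (a B : R) (a_gt0 : 0 < a) (B_gt0 : 0 < B) :
  exists2 C : R, 0 < C &
    forall (F : variance_family) (d1 d2 K r n : nat) (alpha : R)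
           (Pi : 'I_d1 * 'I_d2 -> R)
           (U : 'M[R]_(d1, K)) (V : 'M[R]_(d2, K))
           (pi : probability 'M[R]_(d1, d2) R),
    (1 <= K <= minn d1 d2)%N -> (1 <= r <= K)%N -> (1 < n * d1 * d2)%N ->
    0 < alpha < 1 ->
    is_pmf Pi ->
    lowrank_class r B U V ->
    lowrank_prior K (variance_law F a (b_n B d1 d2 K n)) pi ->
    let Mstar := U *m V^T in
    let eps := eps_n C r d1 d2 n in
    1 - 2 / (n%:R * eps) <=
    sample_prob (obs_pmf Pi Mstar)
      [set z : {ffun 'I_n -> obs d1 d2} |
        (\int[frac_posterior alpha pi z]_M
           (hellinger2 (obs_pmf Pi M) (obs_pmf Pi Mstar))%:E
         <= (c_alpha alpha * eps)%:E)%E].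
Proof.
have C0 := rate_const_gt0 a_gt0 B_gt0.
exists (rate_const a B) => // F d1 d2 K r n alpha Pi U V pi.
move=> /andP[K1 K2] /andP[r1 r2] N1 alpha01 Pi_pmf UV piP; lazy zeta.
set Mstar := U *m V^T; set eps := eps_n _ r d1 d2 n.
have /andP[al0 al1] := alpha01.
have n0 : 0 < n%:R :> R.
  by rewrite ltr0n; case: n N1 {eps piP} => //; rewrite mul0n.
have l2 := ln_sample_ge (R := R) N1.
have d0 : 1 <= (d1 + d2)%:R :> R.
  by rewrite ler1n addn_gt0 (leq_trans K1)// (leq_trans K2)// geq_minl.
have rr : 1 <= r%:R :> R by rewrite ler1n.
pose s : R := r%:R * (d1 + d2)%:R * ln (n * d1 * d2)%:R.
have s2 : 2^-1 <= s.
  by rewrite (le_trans l2)// /s ler_peMl ?mulr_ege1// (le_trans _ l2).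
have xE : n%:R * eps = rate_const a B * s.
  by rewrite /eps /eps_n -/s; field; rewrite gt_eqF.
have x0 : 0 < n%:R * eps by rewrite xE mulr_gt0//; lra.
have eps0 : 0 < eps by rewrite -(pmulr_rgt0 _ n0).
apply: (@frac_posterior_hellinger2 _ _ _ _ _ _ _ _ _ _
  ((1 + B) ^+ 2 / n%:R)) => //.
(* [s >= 1/2] makes the term [4 * (1 + B) ^+ 2] of [rate_const] large enough. *)
- rewrite mulrC divfK ?gt_eqF// xE /rate_const.
  have v0 := variance_const_ge0 a_gt0 B_gt0.
  have g0 := normr_ge0 (ln (normal_floor B)); have B2 := sqr_ge0 (1 + B).
  have h1 : 0 <= (variance_const a B + 2 * `|ln (normal_floor B)| + 2) * s.
    by rewrite mulr_ge0//; lra.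
  have h2 : (1 + B) ^+ 2 <= 2 * s * (1 + B) ^+ 2 by rewrite ler_peMl//; lra.
  by lra.
- by rewrite xE; apply: (lowrank_prior_mass a_gt0 B_gt0 K1 K2 N1 r1 r2 UV piP).
(* The two cases of [c_alpha] are those of the minimum of [alpha] and [1 - alpha], and the product
   of the two is [2 * (alpha + 1)] in each. *)
- rewrite /c_alpha; case: leP => a12.
    by rewrite (min_idPr _); [field; lra|lra].
  by rewrite (min_idPl _); [field; lra|lra].
- rewrite mulr_ge0 ?(ltW eps0)// /c_alpha.
  by case: (leP 2^-1 alpha) => _; rewrite divr_ge0 ?mulr_ge0//; lra.
Qed.
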